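(* Let $\lambda\in\mathbb{R}$, and let either $N\geq 3$ and $1<p\leq 2^\star-1$ with $2^\star=\frac{2N}{N-2}$, or $N=2$ and $1<p<\infty$. Assume $\theta<0$. Consider the equation $$\Delta_{\mathbb{B}^N}u+\lambda u+|u|^{p-1}u+\theta u\ln u^2=0\quad\text{in }\mathbb{B}^N. \qquad (E)$$ (a) If $u\in\mathcal{H}^1(\mathbb{B}^N)$ is a positive solution of (E), then there exist $R_0>0$ and $C_0>0$ such that $$C_0\left(\sinh\frac{d(0,x)}{2}\right)^{-(N-1)}\leq u(x)\quad\text{for all }x\in\mathbb{B}^N\text{ with }d(0,x)\geq R_0.$$ (b) There does not exist any positive solution $u\in\mathcal{H}^1(\mathbb{B}^N)$ of (E).
   Context: $\mathbb{B}^N$ is the ball model of hyperbolic $N$-space: the Euclidean unit ball with the metric $g=\left(\frac{2}{1-|x|^2}\right)^2dx^2$; $\Delta_{\mathbb{B}^N}$, $\nabla_{\mathbb{B}^N}$, $dV_{\mathbb{B}^N}$ are its Laplace–Beltrami operator, gradient and volume element. $d(0,x)=\ln\frac{1+|x|}{1-|x|}$ is the hyperbolic distance from $0$. $\mathcal{H}^1(\mathbb{B}^N)$ is the closure (completion) of $C_c^\infty(\mathbb{B}^N)$ with respect to the norm $$\|u\|_{\lambda_1}=\left(\int_{\mathbb{B}^N}\left(|\nabla_{\mathbb{B}^N}u|_g^2-\lambda_1u^2\right)dV_{\mathbb{B}^N}\right)^{1/2},\qquad \lambda_1=\frac{(N-1)^2}{4},$$ where $\lambda_1$ is the bottom of the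 $L^2$-spectrum of $-\Delta_{\mathbb{B}^N}$. One has $\mathcal{H}^1(\mathbb{B}^N)\subset H^1_{loc}(\mathbb{B}^N)$, and $\mathcal{H}^1(\mathbb{B}^N)$ strictly contains the closure $H^1(\mathbb{B}^N)$ of $C_c^\infty(\mathbb{B}^N)$ in the norm $\left(\int_{\mathbb{B}^N}|\nabla_{\mathbb{B}^N}u|_g^2\,dV_{\mathbb{B}^N}\right)^{1/2}$. Solution: $u\in H^1_{loc}(\mathbb{B}^N)$ is a (weak) solution of (E) if for all $\phi\in C_c^\infty(\mathbb{B}^N)$ $$\int_{\mathbb{B}^N}\langle\nabla_{\mathbb{B}^N}u,\nabla_{\mathbb{B}^N}\phi\rangle_g\,dV_{\mathbb{B}^N}-\lambda\int_{\mathbb{B}^N}u\phi\,dV_{\mathbb{B}^N}=\theta\int_{\mathbb{B}^N}\phi\,u\ln u^2\,dV_{\mathbb{B}^N}+\int_{\mathbb{B}^N}\phi|u|^{p-1}u\,dV_{\mathbb{B}^N}.$$ Weak solutions are smooth by local elliptic regularity, so pointwise values make sense. *)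

(* Defs.v *)
From HB Require Import structures.
From mathcomp Require Import all_boot all_order all_algebra.
From mathcomp Require Import all_classical all_reals all_analysis.
Set Implicit Arguments.
Unset Strict Implicit.
Unset Printing Implicit Defensive.
Import Order.TTheory GRing.Theory Num.Theory.
Import numFieldNormedType.Exports.
Local Open Scope classical_set_scope.
Local Open Scope ring_scope.

(* The sigma-algebra on row vectors generated by the coordinates (same
   construction as the library's one on [n.-tuple T]); for [T] the Borel line
   it is the Borel sigma-algebra of R^n. *)
Definition measure_rV_display : measure_display -> measure_display.
Proof. exact. Qed.

Section measurable_rV.
Context {d} {T : sigmaRingType d}.
Variable n : nat.

Let coors : 'I_n -> 'rV[T]_n -> T := fun i x => x ord0 i.

Let rV_set0 : g_sigma_preimage coors set0.
Proof. exact: sigma_algebra0. Qed.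

Let rV_setC A : g_sigma_preimage coors A -> g_sigma_preimage coors (~` A).
Proof. exact: sigma_algebraC. Qed.

Let rV_bigcup (F : _^nat) : (forall i, g_sigma_preimage coors (F i)) ->
  g_sigma_preimage coors (\bigcup_i (F i)).
Proof. exact: sigma_algebra_bigcup. Qed.

HB.instance Definition _ := @isMeasurable.Build (measure_rV_display d)
  'rV[T]_n (g_sigma_preimage coors) rV_set0 rV_setC rV_bigcup.

End measurable_rV.

Section measurable_rV_lemmas.
Context d (T : measurableType d).

Lemma measurable_coord n (i : 'I_n) :
  measurable_fun [set: 'rV[T]_n] (fun x => x ord0 i).
Proof.
move=> _ Y mY; rewrite setTI; apply: sub_sigma_algebra => /=.
rewrite -bigcup_seq/=; exists i => /=; first by rewrite mem_index_enum.
by exists Y => //; rewrite setTI.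
Qed.

Lemma measurable_fun_coordP d1 (T1 : measurableType d1) n
    (f : T1 -> 'rV[T]_n) :
  (forall i, measurable_fun [set: T1] (fun x => f x ord0 i)) ->
  measurable_fun [set: T1] f.
Proof.
move=> mf.
suff prefS : g_sigma_preimage (fun i => (fun y : 'rV[T]_n => y ord0 i) \o f)
    `<=` measurable.
  rewrite g_sigma_preimage_comp in prefS.
  by move=> _ A mA; apply: prefS; exists A.
apply: smallest_sub; first exact: sigma_algebra_measurable.
case: n => [|n] in f mf *; first by rewrite big_ord0.
rewrite -bigcup_mkord_ord; apply: bigcup_sub => i Ii.
by move=> A [B mB <-]; exact: mf.
Qed.

End measurable_rV_lemmas.

Section lebesgue_measure_rV.
Context {R : realType}.
Local Open Scope ereal_scope.

Definition cons_rV n (p : R * 'rV[R]_n) : 'rV[R]_n.+1 :=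
  row_mx (p.1%:M : 'rV[R]_1) p.2.

Definition uncons_rV n (x : 'rV[R]_n.+1) : R * 'rV[R]_n :=
  (x ord0 ord0, \row_j x ord0 (lift ord0 j)).

Lemma cons_rVE0 n p : @cons_rV n p ord0 ord0 = p.1.
Proof.
rewrite /cons_rV mxE; case: splitP => [j _|//].
by rewrite mxE (ord1 j) mulr1n.
Qed.

Lemma cons_rVES n p j : @cons_rV n p ord0 (lift ord0 j) = p.2 ord0 j.
Proof.
rewrite /cons_rV mxE; case: splitP => [k|k /= [jk]]; first by rewrite ord1.
by congr (p.2 _ _); apply/val_inj.
Qed.

Lemma cons_rVK n : cancel (@cons_rV n) (@uncons_rV n).
Proof.
move=> p; rewrite /uncons_rV cons_rVE0 [RHS]surjective_pairing; congr pair.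
by apply/rowP => j; rewrite mxE cons_rVES.
Qed.

Lemma uncons_rVK n : cancel (@uncons_rV n) (@cons_rV n).
Proof.
move=> x; apply/rowP => i; case: (unliftP ord0 i) => [j|] ->.
  by rewrite cons_rVES /= mxE.
by rewrite cons_rVE0.
Qed.

Lemma measurable_cons_rV n : measurable_fun setT (@cons_rV n).
Proof.
apply: measurable_fun_coordP => i.
case: (unliftP ord0 i) => [j|] ->.
  under eq_fun do rewrite cons_rVES.
  exact: measurableT_comp (measurable_coord j) measurable_snd.
by under eq_fun do rewrite cons_rVE0; exact: measurable_fst.
Qed.

Lemma measurable_uncons_rV n : measurable_fun setT (@uncons_rV n).
Proof.
apply/measurable_fun_pairP; split; first exact: measurable_coord.
apply: measurable_fun_coordP => i.
under eq_fun do rewrite mxE.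
exact: measurable_coord.
Qed.

Definition cons_measure n (mu : {sigma_finite_measure set 'rV[R]_n -> \bar R})
  : set 'rV[R]_n.+1 -> \bar R :=
  pushforward (@lebesgue_measure R \x mu) (@cons_rV n).

Section cons_measure_instances.
Variables (n : nat) (mu : {sigma_finite_measure set 'rV[R]_n -> \bar R}).

Let preim_measurable (A : set 'rV[R]_n.+1) :
  measurable A -> measurable (@cons_rV n @^-1` A).
Proof. by move=> mA; rewrite -[X in measurable X]setTI; exact: measurable_cons_rV. Qed.

Let cons_measure0 : cons_measure mu set0 = 0.
Proof. by rewrite /cons_measure /pushforward preimage_set0 measure0. Qed.

Let cons_measure_ge0 A : 0 <= cons_measure mu A.
Proof. by rewrite /cons_measure /pushforward; exact: measure_ge0. Qed.

Let cons_measure_sigma_additive : semi_sigma_additive (cons_measure mu).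
Proof.
move=> F mF tF mUF; rewrite /cons_measure /pushforward preimage_bigcup.
apply: measure_semi_sigma_additive.
- by move=> k; exact: preim_measurable.
- apply/trivIsetP => /= i j _ _ ij; rewrite -preimage_setI.
  by move/trivIsetP : tF => /(_ _ _ _ _ ij) ->//; rewrite preimage_set0.
- by rewrite -preimage_bigcup; exact: preim_measurable.
Qed.

HB.instance Definition _ := isMeasure.Build _ _ _ (cons_measure mu)
  cons_measure0 cons_measure_ge0 cons_measure_sigma_additive.

Let cons_measure_sigma_finite : sigma_finite setT (cons_measure mu).
Proof.
have /sigma_finiteP[F [TF ndF Foo]] := sigma_finiteT (@lebesgue_measure R).
have /sigma_finiteP[G [TG ndG Goo]] := sigma_finiteT mu.
exists (fun k => @uncons_rV n @^-1` (F k `*` G k)).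
  rewrite -preimage_bigcup -[LHS](preimage_setT (@uncons_rV n)); congr preimage.
  rewrite -setXTT TF TG predeqE => -[x y]; split.
    move=> [/= [k _ Fkx] [l _ Gly]]; exists (maxn k l) => //; split.
    - by move: x Fkx; exact/subsetPset/ndF/leq_maxl.
    - by move: y Gly; exact/subsetPset/ndG/leq_maxr.
  by move=> [k _ []/= ? ?]; split; exists k.
move=> k; have [mFk Fkoo] := Foo k; have [mGk Gkoo] := Goo k; split.
  rewrite -[X in measurable X]setTI; apply: measurable_uncons_rV => //.
  exact: measurableX.
rewrite /cons_measure /pushforward -comp_preimage.
rewrite (_ : @uncons_rV n \o @cons_rV n = id); last first.
  by apply/funext => p; exact: cons_rVK.
by rewrite preimage_id product_measure1E// lte_mul_pinfty// ge0_fin_numE.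
Qed.

HB.instance Definition _ := Measure_isSigmaFinite.Build _ _ _ (cons_measure mu)
  cons_measure_sigma_finite.

End cons_measure_instances.

Fixpoint lebesgue_rV n : {sigma_finite_measure set 'rV[R]_n -> \bar R} :=
  if n is m.+1 then cons_measure (lebesgue_rV m) else \d_(0%R : 'rV[R]_0).

End lebesgue_measure_rV.

Section functions_on_the_ball.
Context {R : realType}.
Variable N : nat.
Local Notation E := 'rV[R]_N.
Local Notation leb := (@lebesgue_rV R N).

Definition dotp (x y : E) : R := \sum_(i < N) x ord0 i * y ord0 i.

(* The norm carried by ['rV[R]_N] in the library is the sup norm; [enorm] is the
   Euclidean one. *)
Definition enorm (x : E) : R := Num.sqrt (dotp x x).

Definition unit_ball : set E := [set x | enorm x < 1].

Definition partial (i : 'I_N) (f : E -> R) : E -> R :=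
  fun x => 'D_(delta_mx ord0 i) f x.

Definition grad (f : E -> R) (x : E) : E := \row_i partial i f x.

Fixpoint Ck (k : nat) (D : set E) (f : E -> R) : Prop :=
  (forall x, D x -> {for x, continuous f}) /\
  (if k is k'.+1 then
     forall i, (forall x, D x -> derivable f x (delta_mx ord0 i)) /\
               Ck k' D (partial i f)
   else True).

Definition smooth_on (D : set E) (f : E -> R) : Prop := forall k, Ck k D f.

(* C_c^oo of the unit ball, each function being extended by 0 to R^N. *)
Definition test_function (f : E -> R) : Prop :=
  smooth_on setT f /\
  exists K : set E, [/\ compact K, K `<=` unit_ball &
                        forall x, ~ K x -> f x = 0].

Definition L2loc (f : E -> R) : Prop :=
  measurable_fun unit_ball f /\
  forall K : set E, compact K -> K `<=` unit_ball ->
    (\int[leb]_(x in K) ((f x) ^+ 2)%:E < +oo)%E.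

(* [u] is in H^1_loc of the ball and [G] is its weak (Euclidean) gradient; the
   Euclidean and hyperbolic H^1_loc coincide, since on compact subsets of the
   ball the two metrics are comparable. *)
Definition weak_gradient (u : E -> R) (G : E -> E) : Prop :=
  [/\ L2loc u,
      forall i, L2loc (fun x => G x ord0 i) &
      forall f i, test_function f ->
        \int[leb]_(x in unit_ball) (u x * partial i f x) =
        - \int[leb]_(x in unit_ball) (G x ord0 i * f x)].

Definition H1loc (u : E -> R) : Prop := exists G, weak_gradient u G.

End functions_on_the_ball.

Arguments unit_ball {R} N.

Section hyperbolic_ball.
Context {R : realType}.
Variable N : nat.
Local Notation E := 'rV[R]_N.
Local Notation leb := (@lebesgue_rV R N).

Definition conformal_factor (x : E) : R := 2 / (1 - enorm x ^+ 2).

Definition gmetric (x : E) (v w : E) : R := conformal_factor x ^+ 2 * dotp v w.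

(* The Riemannian gradient at [x] of a function whose Euclidean gradient at [x]
   is [v]: the vector representing [w |-> dotp v w] for [gmetric x]. *)
Definition hgrad (x : E) (v : E) : E := (conformal_factor x ^+ 2)^-1 *: v.

(* Integration against dV = (2 / (1 - |x|^2))^N dx on the ball. *)
Definition hintegrable (f : E -> R) : Prop :=
  leb.-integrable (unit_ball N)
    (fun x => (f x * conformal_factor x ^+ N)%:E).

Definition hintegral (f : E -> R) : R :=
  \int[leb]_(x in unit_ball N) (f x * conformal_factor x ^+ N).

Definition hdist0 (x : E) : R := ln ((1 + enorm x) / (1 - enorm x)).

Definition lambda1 : R := (N%:R - 1) ^+ 2 / 4.

Definition norm_lambda1 (f : E -> R) : R :=
  Num.sqrt (hintegral (fun x =>
    gmetric x (hgrad x (grad f x)) (hgrad x (grad f x))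
    - lambda1 * f x ^+ 2)).

(* The completion of the test functions for [norm_lambda1], realized inside
   H^1_loc: the class of a Cauchy sequence is identified with its limit in
   H^1_loc. *)
Definition calH1 (u : E -> R) : Prop :=
  exists (G : E -> E) (f : nat -> E -> R),
  [/\ weak_gradient u G,
      forall n, test_function (f n),
      forall eps : R, 0 < eps -> exists n0 : nat, forall m n : nat,
        (n0 <= m)%N -> (n0 <= n)%N ->
        norm_lambda1 (fun x => f m x - f n x) < eps &
      forall K : set E, compact K -> K `<=` unit_ball N ->
        (fun n => \int[leb]_(x in K) ((f n x - u x) ^+ 2)%:E)%E @ \oo --> 0%E /\
        (fun n => \int[leb]_(x in K)
           (enorm (grad (f n) x - G x) ^+ 2)%:E)%E @ \oo --> 0%E].

(* The integrals of the weak formulation are required to converge; for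
   [theta_term] and [power_term] this is automatic when [p] is at most critical.
   [ln 0] and [0 `^ (p - 1)] are 0, so the nonlinear terms vanish where [u] does. *)
Definition weak_solution (lam p theta : R) (u : E -> R) : Prop :=
  exists2 G : E -> E, weak_gradient u G &
  forall f, test_function f ->
  let dirichlet_term x := gmetric x (hgrad x (G x)) (hgrad x (grad f x)) in
  let linear_term x := u x * f x in
  let theta_term x := f x * u x * ln (u x ^+ 2) in
  let power_term x := f x * (`|u x| `^ (p - 1)) * u x in
  [/\ hintegrable dirichlet_term,
      hintegrable linear_term,
      hintegrable theta_term,
      hintegrable power_term &
      hintegral dirichlet_term - lam * hintegral linear_term =
      theta * hintegral theta_term + hintegral power_term].

Definition eq_on_ball_ae (u v : E -> R) : Prop :=
  {ae leb, forall x, unit_ball N x -> u x = v x}.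

(* Elements of H^1_loc are classes modulo null sets. *)
Definition positive_on_ball (u : E -> R) : Prop :=
  {ae leb, forall x, unit_ball N x -> 0 < u x}.

Definition positive_solution (lam p theta : R) (u : E -> R) : Prop :=
  weak_solution lam p theta u /\ positive_on_ball u.

End hyperbolic_ball.

Arguments lambda1 {R} N.

Definition sinh {R : realType} (t : R) : R := (expR t - expR (- t)) / 2.

(* The critical Sobolev exponent, for N >= 3. *)
Definition two_star {R : realType} (N : nat) : R := 2 * N%:R / (N%:R - 2).

(* Main.v *)
(* Part (b) is proved directly, and part (a) is then vacuous.

   Write rho = (1 - |x|^2) / 2, so that the metric is dx^2 / rho^2. As theta < 0, one has
   lam u + theta u ln u^2 + u^p >= M u - C u^2 for every M, with C depending on M: the
   potential is arbitrarily large where u is small. Testing the equation with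
   phi^2 / u (smoothed, with u replaced by the test functions approximating it in
   calH1) gives, up to constants,
     M int phi^2 dV <= int |grad phi|^2 dV + C^2 int phi^2 u^2 dV
   for every test function phi. The supersolution rho^((N-1)/2) of the operator
   - Delta - lambda1 yields the Hardy inequality
     (N-1)/2 int f^2 rho dV <= int (|grad f|^2 - lambda1 f^2) dV,
   hence int u^2 rho dV < oo for u in calH1. Finally let phi be a function of rho / eps,
   smooth and vanishing for rho <= eps. Integrating the divergence of radial vector
   fields shows that eps^(N-1) int phi^2 dV is bounded below and
   eps^(N-1) int |grad phi|^2 dV is bounded above, while
   eps^(N-1) int phi^2 u^2 dV -> 0 as eps -> 0 since it is dominated by
   int u^2 rho dV. For M large this is a contradiction. *)

Require Import Defs.
From HB Require Import structures.
From mathcomp Require Import all_boot all_order all_algebra.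
From mathcomp Require Import all_classical all_reals all_analysis.
From mathcomp Require Import measurable_realfun ring lra.
Set Implicit Arguments.
Unset Strict Implicit.
Unset Printing Implicit Defensive.
Import Order.TTheory GRing.Theory Num.Theory.
Import numFieldNormedType.Exports.
Local Open Scope classical_set_scope.
Local Open Scope ring_scope.

(** * Calculus of smooth functions on open sets *)

Section Ck_theory.
Context {R : realType} {N : nat}.
Local Notation E := 'rV[R]_N.
Implicit Types (D : set E) (f g : E -> R) (k : nat).

(** The weak formulation admits only smooth compactly supported functions, while [u] is merely in
    H^1_loc, positive almost everywhere, with no positive lower bound at hand; so [1 / u] is reached
    by two limits. The reciprocal becomes [sinv eta], bounded with bounded derivative on the whole
    line, evaluated at the approximants [f n], which may change sign; [n] tends to infinity at fixed
    [eta], then [eta] to [0]. What the substitute must keep is [g' <= - c * g ^ 2] with [c > 0]: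
    Young's inequality then removes the unknown gradient of [u] and leaves only that of [phi]. All
    integrals are Lebesgue integrals with powers of [rho]: for [m = N - 1], [dV] is [rho ^ - N dx]
    and [rho dV] is [rho ^ - m dx]. The scale [eps ^ - m] is the order of the hyperbolic volume of
    [rho >= eps]. Mass and energy of [phi] both have this order, so only a large coefficient can
    separate them. It is fixed first, from the ratio of the two constants; this fixes the
    coefficient of the [u ^ 2] term, and [eps] is chosen last. *)

Lemma Ck_continuous k D f x : Ck k D f -> D x -> {for x, continuous f}.
Proof. by case: k => [|k] [cf _]; exact: cf. Qed.

Lemma CkS_partial k D f i : Ck k.+1 D f -> Ck k D (partial i f).
Proof. by move=> [_ /(_ i)[]]. Qed.

Lemma CkS_derivable k D f i x :
  Ck k.+1 D f -> D x -> derivable f x (delta_mx ord0 i).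
Proof. by move=> [_ /(_ i)[df _]]; exact: df. Qed.

Lemma CkW k D f : Ck k.+1 D f -> Ck k D f.
Proof.
elim: k f => [|k IH] f [cf df]; first by split.
by split=> // i; have [d1 d2] := df i; split=> //; exact: IH.
Qed.

Lemma Ck_sub k D D' f : D' `<=` D -> Ck k D f -> Ck k D' f.
Proof.
move=> sD; elim: k f => [|k IH] f [cf df]; first by split=> // x /sD; exact: cf.
split=> [x /sD|i]; first exact: cf.
by have [d1 d2] := df i; split=> [x /sD|]; [exact: d1|exact: IH].
Qed.

Lemma Ck_setU k D D' f : Ck k D f -> Ck k D' f -> Ck k (D `|` D') f.
Proof.
elim: k f => [|k IH] f [cf df] [cf' df'].
  by split=> // x [Dx|D'x]; [exact: cf|exact: cf'].
split=> [x [Dx|D'x]|i]; [exact: cf|exact: cf'|].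
have [d1 d2] := df i; have [d1' d2'] := df' i; split; last exact: IH.
by move=> x [Dx|D'x]; [exact: d1|exact: d1'].
Qed.

Lemma open_near_eq D f g x : open D -> D x -> (forall y, D y -> f y = g y) ->
  \near x, f x = g x.
Proof.
by move=> oD Dx fg; apply: filterS fg _; apply: open_nbhs_nbhs; split.
Qed.

Lemma open_eq_continuous D f g x : open D -> D x ->
  (forall y, D y -> f y = g y) ->
  {for x, continuous f} -> {for x, continuous g}.
Proof.
move=> oD Dx fg cf; rewrite /prop_for /continuous_at -fg//.
by apply: cvg_trans cf; exact/(@near_eq_cvg _ _ (nbhs x))/(open_near_eq oD Dx).
Qed.

Lemma Ck_eq k D f g : open D -> (forall x, D x -> f x = g x) ->
  Ck k D f -> Ck k D g.
Proof.
move=> oD; elim: k f g => [|k IH] f g fg [cf df].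
  by split=> // x Dx; apply: (open_eq_continuous oD Dx fg); exact: cf.
split=> [x Dx|i]; first by apply: (open_eq_continuous oD Dx fg); exact: cf.
have [d1 d2] := df i; split.
  by move=> x Dx; apply: near_eq_derivable (open_near_eq oD Dx fg) (d1 x Dx).
by apply: IH d2 => x Dx; exact/near_eq_derive/(open_near_eq oD Dx).
Qed.

Lemma Ck_cst k D (c : R) : Ck k D (fun=> c).
Proof.
elim: k c => [|k IH] c; split=> //; try by move=> x _; exact: cst_continuous.
move=> i; split=> [x _|]; first exact: (derivable_cst c x).
rewrite (_ : partial i (fun=> c) = fun=> 0); first exact: IH.
by apply/funext => x; exact: derive_cst.
Qed.

Lemma partial_coord i j :
  partial i (fun x : E => x ord0 j) = fun=> (i == j)%:R.
Proof.
apply/funext => x; rewrite /partial deriveE; last exact: differentiable_coord.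
have @f : {linear E -> R}.
  by exists (fun x : E => x ord0 j); do 2![eexists]; do ?[constructor];
     rewrite ?mxE// => ? *; rewrite ?mxE//; move=> ?; rewrite !mxE.
rewrite (_ : (fun x : E => x ord0 j) = f)// diff_lin; last exact: coord_continuous.
by rewrite /= mxE eqxx/= eq_sym.
Qed.

Lemma Ck_coord k D j : Ck k D (fun x : E => x ord0 j).
Proof.
case: k => [|k]; split=> //; try by move=> x _; exact: coord_continuous.
move=> i; split=> [x _|]; first exact/diff_derivable/differentiable_coord.
by rewrite partial_coord; exact: Ck_cst.
Qed.

Lemma Ck_add k D f g : open D ->
  Ck k D f -> Ck k D g -> Ck k D (fun x => f x + g x).
Proof.
move=> oD; elim: k f g => [|k IH] f g [cf df] [cg dg].
  by split=> // x Dx; exact: continuousD (cf x Dx) (cg x Dx).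
split=> [x Dx|i]; first by exact: continuousD (cf x Dx) (cg x Dx).
have [f1 f2] := df i; have [g1 g2] := dg i; split=> [x Dx|].
  exact: (derivableD (f1 x Dx) (g1 x Dx)).
apply: Ck_eq oD _ (IH _ _ f2 g2) => x Dx.
exact/esym/(deriveD (f1 x Dx) (g1 x Dx)).
Qed.

Lemma Ck_mul k D f g : open D ->
  Ck k D f -> Ck k D g -> Ck k D (fun x => f x * g x).
Proof.
move=> oD; elim: k f g => [|k IH] f g cf cg.
  by split=> // x Dx; exact: continuousM (Ck_continuous cf Dx) (Ck_continuous cg Dx).
split=> [x Dx|i].
  by exact: continuousM (Ck_continuous cf Dx) (Ck_continuous cg Dx).
split=> [x Dx|].
  exact: (derivableM (CkS_derivable cf Dx) (CkS_derivable cg Dx)).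
have h1 := IH _ _ (CkW cf) (CkS_partial i cg).
have h2 := IH _ _ (CkW cg) (CkS_partial i cf).
apply: Ck_eq oD _ (Ck_add oD h1 h2) => x Dx.
exact/esym/(deriveM (CkS_derivable cf Dx) (CkS_derivable cg Dx)).
Qed.

Lemma Ck_exp k D f n : open D -> Ck k D f -> Ck k D (fun x => f x ^+ n).
Proof.
move=> oD cf; elim: n => [|n IH]; first exact: Ck_cst.
by under eq_fun do rewrite exprS; exact: Ck_mul.
Qed.

Lemma Ck_sum k D n (f : 'I_n -> E -> R) : open D ->
  (forall i, Ck k D (f i)) -> Ck k D (fun x => \sum_(i < n) f i x).
Proof.
move=> oD cf; elim: n f cf => [|n IH] f cf.
  by under eq_fun do rewrite big_ord0; exact: Ck_cst.
by under eq_fun do rewrite big_ord_recl; apply: Ck_add => //; exact: IH.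
Qed.

Lemma Ck_inv k D f : open D -> (forall x, D x -> f x != 0) ->
  Ck k D f -> Ck k D (fun x => (f x)^-1).
Proof.
move=> oD f0; elim: k => [|k IH] cf.
  by split=> // x Dx; apply: continuousV (Ck_continuous cf Dx); exact: f0.
split=> [x Dx|i]; first by apply: continuousV (Ck_continuous cf Dx); exact: f0.
split=> [x Dx|].
  exact: (derivableV (f0 _ Dx) (CkS_derivable cf Dx)).
have h1 := IH (CkW cf).
have h2 := Ck_mul oD (Ck_mul oD (Ck_cst k D (-1)) (Ck_exp 2 oD h1))
  (CkS_partial i cf).
apply: Ck_eq oD _ h2 => x Dx.
rewrite /partial (deriveV (f0 _ Dx) (CkS_derivable cf Dx)).
by rewrite exprVn mulN1r.
Qed.

Lemma derive_line f x v : derivable f x v ->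
  is_derive (0 : R) (1 : R) (fun h : R => f (h *: v + x)) ('D_v f x).
Proof.
move=> dfx; apply: DeriveDef; first exact: ((derivable1P f x v).1 dfx).
rewrite /derive; set g1 := fun h => h^-1 *: _; set g2 := fun h => h^-1 *: _.
suff -> : g1 = g2 by [].
by rewrite funeqE /g1 /g2 => h /=; rewrite addr0 scale0r add0r [_%:A]mulr1.
Qed.

(** Only a directional derivative of [f] is available, not a differential, so the chain rule is
    applied to the restriction of [f] to the line through [x] along [v], a function of one
    variable. *)
Lemma is_derive_comp_line (h : R -> R) dh f (x v : E) : derivable f x v ->
  is_derive (f x) (1 : R) h dh -> is_derive x v (h \o f) (dh * 'D_v f x).
Proof.
move=> dfx hfx; have := derive_line dfx.
have : f (0 *: v + x) = f x by rewrite scale0r add0r.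
have d0 : derivable (h \o f) x v <-> derivable (h \o (fun t : R => f (t *: v + x))) (0 : R) (1 : R).
  exact: derivable1P.
have d1 : 'D_v (h \o f) x = 'D_(1 : R) (h \o (fun t : R => f (t *: v + x))) (0 : R).
  rewrite /derive.
  set g1 := fun h => h^-1 *: _; set g2 := fun h => h^-1 *: _.
  suff -> : g1 = g2 by [].
  by rewrite funeqE /g1 /g2 => t /=; rewrite addr0 scale0r add0r [_%:A]mulr1.
move: d0 d1; set g := fun t : R => f (t *: v + x) => d0 d1 g0 dg.
have hl : is_derive (0 : R) (1 : R) (h \o g) (dh * 'D_v f x).
  by apply: is_derive1_comp; rewrite /g g0.
apply: DeriveDef; first exact: (d0.2 (@ex_derive _ _ _ _ _ _ _ hl)).
by rewrite d1; exact: (@derive_val _ _ _ _ _ _ _ hl).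
Qed.

Lemma partial_comp (h : R -> R) dh f x i : derivable f x (delta_mx ord0 i) ->
  is_derive (f x) (1 : R) h dh -> partial i (h \o f) x = dh * partial i f x.
Proof.
by move=> df dhf; exact: (@derive_val _ _ _ _ _ _ _ (is_derive_comp_line df dhf)).
Qed.

(** A class [S] of one-variable functions closed under differentiation stands for smoothness of [h]:
    the induction on [k] passes from [h] to [h'] inside [S], and no iterated derivative is
    needed. *)
Lemma Ck_comp (S : (R -> R) -> Prop) k D f (h : R -> R) : open D ->
  (forall h, S h -> exists2 h' : R -> R, S h' &
     forall t, is_derive t (1 : R) h (h' t)) ->
  S h -> Ck k D f -> Ck k D (h \o f).
Proof.
move=> oD SS; elim: k f h => [|k IH] f h Sh cf.
  have [h' _ dh] := SS _ Sh; split=> // x Dx.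
  apply: continuous_comp; first exact: (Ck_continuous cf).
  exact/differentiable_continuous/derivable1_diffP.
have [h' Sh' dh] := SS _ Sh; split=> [x Dx|i].
  apply: continuous_comp; first exact: (Ck_continuous cf).
  exact/differentiable_continuous/derivable1_diffP.
split=> [x Dx|].
  exact: (@ex_derive _ _ _ _ _ _ _ (is_derive_comp_line (CkS_derivable cf Dx) (dh (f x)))).
have h1 := Ck_mul oD (IH _ _ Sh' (CkW cf)) (CkS_partial i cf).
apply: Ck_eq oD _ h1 => x Dx /=.
exact/esym/(partial_comp (CkS_derivable cf Dx) (dh _)).
Qed.

Lemma Ck_zero k D f : open D -> (forall x, D x -> f x = 0) -> Ck k D f.
Proof. by move=> oD f0; apply: Ck_eq oD _ (Ck_cst k D 0) => x /f0. Qed.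

Lemma partial_zero D f i x : open D -> (forall x, D x -> f x = 0) -> D x ->
  partial i f x = 0.
Proof.
move=> oD f0 Dx;
rewrite /partial (@near_eq_derive _ _ _ f (cst 0)); first exact: derive_cst.
exact: (open_near_eq oD).
Qed.

End Ck_theory.

(** * Functions flat at the origin *)

Section flat.
Context {R : realType}.
Implicit Types (p : {poly R}) (t : R).

(* A family containing [exp (- 1 / t)] that is closed under differentiation, hence made
   of smooth functions. *)
Definition flat p t : R := if 0 < t then p.[t^-1] * expR (- t^-1) else 0.

(** Coefficient by coefficient, from [y ^ n * exp (- y) <= n!], which is one term of the exponential
    series. *)
Lemma expR_poly_bounded p : exists C : R, forall y : R, 0 < y ->
  `|p.[y] * expR (- y)| <= C.
Proof.
have mono n (y : R) : 0 < y -> y ^+ n * expR (- y) <= n`!%:R.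
  move=> y0; rewrite expRN ler_pdivrMr ?expR_gt0//.
  case: n => [|n].
    by rewrite expr0 fact0 mul1r -expR0 ler_expR ltW.
  rewrite mulrC -ler_pdivrMr ?ltr0n ?fact_gt0//.
  by apply: le_trans (expR_ge1Dxn n (ltW y0)); rewrite lerDr.
have [n np] : exists n, (size p <= n)%N by exists (size p).
exists (\sum_(i < size p) `|p`_i| * i`!%:R) => y y0.
rewrite horner_coef mulr_suml; apply: le_trans (ler_norm_sum _ _ _) _.
apply: ler_sum => i _; rewrite -mulrA normrM ler_wpM2l//.
by rewrite ger0_norm ?mono// mulr_ge0 ?expR_ge0// exprn_ge0// ltW.
Qed.

(** Boundedness of [X^2 * p] against [exp (- X)], read at [X = 1 / t]. Quadratic vanishing makes the
    difference quotient at [0] tend to [0]. *)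
Lemma flat_le p : exists C : R, forall t, `|flat p t| <= C * t ^+ 2.
Proof.
have [C HC] := expR_poly_bounded ('X^2 * p).
have C0 : 0 <= C by apply: le_trans (HC 1 ltr01).
exists C => t; rewrite /flat; case: ifPn => t0; last first.
  by rewrite normr0 mulr_ge0// sqr_ge0.
have := HC t^-1; rewrite invr_gt0 t0 => /(_ isT).
rewrite hornerM hornerXn -mulrA exprVn normrM ger0_norm ?invr_ge0 ?exprn_ge0 ?(ltW t0)//.
by rewrite ler_pdivrMl ?exprn_gt0// [_ * C]mulrC.
Qed.

(** In the variable [X = 1 / t] the operator [d/dt] is [- X^2 d/dX], and applied to [p(X) exp (- X)]
    it gives the polynomial factor [X^2 * (p - p')]. *)
Lemma is_derive_flat p t : is_derive t (1 : R) (flat p) (flat ('X^2 * (p - p^`())) t).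
Proof.
have [t0|t0|->] := ltgtP t 0.
- rewrite /flat ltNge ltW//=.
  apply: near_eq_is_derive (is_derive_cst (0 : R) t (1 : R)).
  near=> y; rewrite ifF//; apply/negbTE; rewrite -leNgt ltW//; near: y.
  exact: lt_nbhsl.
- rewrite {2}/flat t0.
  have dV : is_derive t (1 : R) (fun y : R => y^-1) (- t ^- 2 *: 1).
    have := @is_deriveV R id t 1 1 (lt0r_neq0 t0) (is_derive_id _ _).
    by [].
  have dE : is_derive t (1 : R) (expR \o (fun y : R => - y^-1)) (expR (- t^-1) * - (- t ^- 2 *: 1)).
    by apply: is_derive1_comp; exact: is_deriveN.
  have dp : is_derive (t^-1) (1 : R) (horner p) p^`().[t^-1].
    have -> : p^`().[t^-1] = 'D_1 (horner p) t^-1 by rewrite -derive1E -derivE.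
    exact/derivableP/derivable_horner.
  have dP : is_derive t (1 : R) (horner p \o (fun y : R => y^-1)) (p^`().[t^-1] * (- t ^- 2 *: 1)).
    exact: is_derive1_comp.
  have key := is_deriveM dP dE.
  apply: is_derive_eq (near_eq_is_derive _ key) _ => /=.
    near=> y; rewrite /flat ifT//; near: y; exact: lt_nbhsr.
  rewrite !hornerE /GRing.scale/=; field; exact: lt0r_neq0.
- rewrite {2}/flat ltxx.
  have f0 : flat p 0 = 0 by rewrite /flat ltxx.
  have [C HC] := flat_le p.
  have C0 : 0 <= C by have := HC 1; rewrite expr1n mulr1; apply: le_trans.
  have lim0 : (fun h => h^-1 *: (flat p (h *: 1 + 0) - flat p 0)) @ (0:R)^' --> (0:R).
    apply/cvgr0Pnorm_le => e e0; near=> h.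
    rewrite addr0 f0 subr0 [h *: 1]mulr1 normrM.
    have h0 : h != 0 by near: h; exact: nbhs_dnbhs_neq.
    rewrite normfV mulrC ler_pdivrMr ?normr_gt0//.
    apply: le_trans (HC h) _; rewrite -[h ^+ 2]real_normK ?num_real// expr2 mulrA.
    rewrite ler_wpM2r//.
    have : `|h| <= e / (C + 1).
      near: h; exact: dnbhs0_le (divr_gt0 e0 (ltr_wpDl C0 ltr01)).
    rewrite ler_pdivlMr ?ltr_wpDl// => hle; apply: le_trans hle.
    by rewrite mulrC ler_wpM2l// lerDl.
  by apply: DeriveDef; [apply/cvg_ex; exists 0|exact: cvg_lim].
Unshelve. all: by end_near. Qed.

Lemma Ck_flat N k D (f : 'rV[R]_N -> R) p : open D -> Ck k D f ->
  Ck k D (flat p \o f).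
Proof.
move=> oD; apply: (@Ck_comp _ _ (fun h => exists q, h = flat q)) => //; last by exists p.
move=> _ [q ->]; exists (flat ('X^2 * (q - q^`()))); first by eexists.
exact: is_derive_flat.
Qed.

End flat.

(** * Lebesgue measure and integration by parts *)

Section rV_topology_measure.
Context {R : realType}.

Definition box n (r : R) : set 'rV[R]_n := [set x | forall j, `|x ord0 j| <= r].

Lemma cvg_rV (T : topologicalType) n (F : set_system T) {FF : Filter F}
    (M : T -> 'rV[R]_n) (l : 'rV[R]_n) :
  (forall j, (fun t => M t ord0 j) @ F --> l ord0 j) -> M @ F --> l.
Proof.
move=> cM; apply/cvg_ballP => e e0.
have : \forall t \near F, forall j, ball (l ord0 j) e (M t ord0 j).
  apply: filter_forall => j.
  by have /cvg_ballP/(_ e e0) := cM j.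
apply: filterS => t Ht; split=> // i j; rewrite (ord1 i); exact: Ht.
Qed.

(** The sigma-algebra is generated by the coordinates, so second countability is used: [U] is the
    countable union of the open cubes with rational centre and half-side [1 / (k + 1)] that it
    contains. *)
Lemma open_measurable_rV n (U : set 'rV[R]_n) : open U -> measurable U.
Proof.
move=> oU.
pose B (qk : 'rV[rat]_n * nat) : set 'rV[R]_n :=
  \bigcap_(j in [set: 'I_n]) (fun x : 'rV[R]_n => x ord0 j) @^-1`
     `]ratr (qk.1 ord0 j) - qk.2.+1%:R^-1, ratr (qk.1 ord0 j) + qk.2.+1%:R^-1[.
have mB qk : measurable (B qk).
  apply: fin_bigcap_measurable => // j _; rewrite -[X in measurable X]setTI.
  exact: (@measurable_coord _ R n j).
have -> : U = \bigcup_qk (if `[< B qk `<=` U >] then B qk else set0).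
  apply/seteqP; split=> [x Ux|x [qk _]]; last first.
    by case: ifPn => // /asboolP BU; exact: BU.
  have /nbhs_ballP[e /= e0 He] : nbhs x U by apply: open_nbhs_nbhs; split.
  have [k Hk] : exists k : nat, k.+1%:R^-1 < e / 2.
    have /cvgrPdist_lt/(_ (e / 2)) := @cvg_harmonic R.
    rewrite divr_gt0// => /(_ isT).
    move=> [k _ /(_ k (leqnn _))] /=; rewrite sub0r normrN ger0_norm ?invr_ge0//.
    by exists k.
  have k0 : (0 : R) < k.+1%:R^-1 by rewrite invr_gt0.
  have qP j : exists q : rat, x ord0 j - k.+1%:R^-1 < ratr q < x ord0 j + k.+1%:R^-1.
    have : x ord0 j - k.+1%:R^-1 < x ord0 j + k.+1%:R^-1.
      by rewrite ltrBlDr -addrA ltrDl addr_gt0.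
    by move=> /rat_in_itvoo[q]; rewrite in_itv/=; exists q.
  pose q : 'rV[rat]_n := \row_j sval (cid (qP j)).
  exists (q, k) => //.
  have xB : B (q, k) x.
    move=> j _ /=; rewrite in_itv/= /q mxE.
    case: cid => p /= /andP[p1 p2].
    by rewrite ltrBlDr p2 -ltrBlDr p1.
  rewrite ifT//; apply/asboolP => y yB; apply: He; split=> // i j.
  rewrite (ord1 i) /ball/=.
  have := xB j I; have := yB j I; rewrite /= !in_itv/= => /andP[a b] /andP[c d].
  move: a b c d Hk; move: (k.+1%:R^-1 : R) (ratr _ : R) => a b *.
  by rewrite ltr_norml; apply/andP; split; lra.
apply: countable_bigcupT_measurable => [|qk]; first exact: countableP.
by case: ifPn.
Qed.

Lemma closed_measurable_rV n (A : set 'rV[R]_n) : closed A -> measurable A.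
Proof.
move=> cA; rewrite -[A]setCK; apply: measurableC; apply: open_measurable_rV.
exact: closed_openC.
Qed.

Lemma compact_closed_rV n (A : set 'rV[R]_n) : compact A -> closed A.
Proof. by apply: compact_closed; exact: norm_hausdorff. Qed.

Lemma compact_measurable_rV n (A : set 'rV[R]_n) : compact A -> measurable A.
Proof. by move=> /compact_closed_rV; exact: closed_measurable_rV. Qed.

Lemma continuous_measurable_rV n (f : 'rV[R]_n -> R) : continuous f ->
  measurable_fun setT f.
Proof.
move=> /continuousP cf; apply: (measurability _ (measurable_realfun.RGenOpens.measurableE R)).
move=> _ [_ [a [b ->] <-]]; rewrite setTI.
by apply: open_measurable_rV; apply: cf; exact: interval_open.
Qed.

Lemma compact_box n r : compact (@box n r).
Proof.
rewrite (_ : box r = [set v : 'rV[R]_n | forall i, `[- r, r]%classic (v ord0 i)]).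
  by apply: (@rV_compact R n (fun=> `[- r, r]%classic)) => i; exact: segment_compact.
by apply/seteqP; split=> x /= Hx j; have := Hx j; rewrite /= in_itv/= ler_norml.
Qed.

Lemma measurable_box n r : measurable (@box n r).
Proof. by apply: compact_measurable_rV; exact: compact_box. Qed.

Lemma lebesgue_box n (r : R) : 0 <= r -> (lebesgue_rV n (@box n r) = ((2 * r) ^+ n)%:E)%E.
Proof.
move=> r0; elim: n => [|n IH].
  by rewrite expr0 /= /dirac/= indicE mem_set// => -[].
rewrite /= /cons_measure /pushforward.
have -> : @cons_rV R n @^-1` @box n.+1 r = `[- r, r] `*` box r.
  apply/seteqP; split=> [[t y] /= H|[t y] /= [Ht Hy] j].
    split=> [|j]; rewrite /= ?in_itv/= -?ler_norml.
      by have := H ord0; rewrite cons_rVE0.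
    by have := H (lift ord0 j); rewrite cons_rVES.
  case: (unliftP ord0 j) => [k|] ->; first by rewrite cons_rVES; exact: Hy.
  by rewrite cons_rVE0; move: Ht; rewrite in_itv/= ler_norml.
rewrite product_measure1E//; last exact: measurable_box.
rewrite exprS EFinM -IH; congr (_ * _)%E.
rewrite [LHS](lebesgue_measure_itv `[- r, r]%R) /=; case: ifPn; rewrite lte_fin.
  by move=> _; rewrite -EFinB; congr (_%:E); ring.
by rewrite -leNgt => h; congr (_%:E); lra.
Qed.

End rV_topology_measure.

Section integration_by_parts.
Context {R : realType}.

Lemma compact_continuous_bounded n (f : 'rV[R]_n -> R) (K : set 'rV[R]_n) :
  compact K -> continuous f -> exists2 C : R, 0 < C & forall x, K x -> `|f x| <= C.
Proof.
move=> cK cf.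
have cfK : compact (f @` K).
  by apply: continuous_compact => //; exact: continuous_subspaceT.
have [M [_ HM]] := compact_bounded cfK.
exists (`|M| + 1); first by rewrite ltr_wpDl.
move=> x Kx; apply: (HM (`|M| + 1)); last by exists x.
by rewrite ltr_pwDr// ler_norm.
Qed.

Lemma integrable_continuous_box n (f : 'rV[R]_n -> R) r : continuous f ->
  (forall x, ~ box r x -> f x = 0) ->
  (lebesgue_rV n).-integrable setT (EFin \o f).
Proof.
move=> cf f0.
have {}f0 : forall x, ~ box `|r| x -> f x = 0.
  move=> x Bx; apply: f0; apply: contra_not Bx => Bx j.
  by apply: le_trans (Bx j) _; exact: ler_norm.
have -> : EFin \o f = ((EFin \o f) \_ (@box R n `|r|)).
  apply/funext => x; rewrite patchE; case: ifPn => //= /negP; rewrite inE => xB.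
  by rewrite f0.
apply/(integrable_mkcond _ (@measurable_box _ n `|r|)).1.
apply: measurable_bounded_integrable.
- exact: measurable_box.
- have : (lebesgue_rV n (@box R n `|r|) < +oo)%E by rewrite lebesgue_box// ltry.
  exact.
- by apply: measurable_funTS; exact: continuous_measurable_rV.
have [C C0 HC] := compact_continuous_bounded (@compact_box _ n `|r|) cf.
exists C; split; first by rewrite num_real.
by move=> M CM x Bx; apply: le_trans (HC x Bx) _; exact: ltW.
Qed.

Lemma integrable_cons n (f : 'rV[R]_n.+1 -> R) :
  measurable_fun setT f ->
  (lebesgue_rV n.+1).-integrable setT (EFin \o f) ->
  (@lebesgue_measure R \x lebesgue_rV n)%E.-integrable setT
    (fun z => (f (cons_rV z))%:E).
Proof.
move=> mf /integrableP[_ fi]; apply/integrableP; split.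
  apply/measurable_EFinP; apply: measurableT_comp => //.
  exact: measurable_cons_rV.
move: fi; rewrite /= /cons_measure ge0_integral_pushforward//.
- exact: measurable_cons_rV.
- by apply: measurableT_comp => //; exact: measurableT_comp.
Qed.

Lemma integral_cons n (f : 'rV[R]_n.+1 -> R) :
  measurable_fun setT f ->
  (lebesgue_rV n.+1).-integrable setT (EFin \o f) ->
  (\int[lebesgue_rV n.+1]_x (f x)%:E =
   \int[(@lebesgue_measure R \x lebesgue_rV n)]_z (f (cons_rV z))%:E)%E.
Proof.
move=> mf fi; have fci := integrable_cons mf fi.
rewrite /= /cons_measure integral_pushforward//.
- exact: measurable_cons_rV.
- exact/measurable_EFinP.
Qed.

Lemma addZ_delta_rV n (h : R) (x : 'rV[R]_n) i j :
  (h *: delta_mx ord0 i + x) ord0 j = h * (j == i)%:R + x ord0 j.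
Proof. by rewrite mxE; congr (_ + _); rewrite !mxE eqxx. Qed.

Lemma cons_rV_shift0 n (h t : R) (y : 'rV[R]_n) :
  cons_rV (h + t, y) = h *: delta_mx ord0 ord0 + cons_rV (t, y).
Proof.
apply/rowP => j; rewrite addZ_delta_rV; case: (unliftP ord0 j) => [k|] ->.
  by rewrite !cons_rVES/= mulr0 add0r.
by rewrite !cons_rVE0/= mulr1.
Qed.

Lemma cons_rV_shiftS n (h t : R) (y : 'rV[R]_n) j :
  cons_rV (t, h *: delta_mx ord0 j + y) =
  h *: delta_mx ord0 (lift ord0 j) + cons_rV (t, y).
Proof.
apply/rowP => i; rewrite addZ_delta_rV; case: (unliftP ord0 i) => [k|] ->.
  by rewrite !cons_rVES addZ_delta_rV (inj_eq lift_inj).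
by rewrite !cons_rVE0/= mulr0 add0r.
Qed.

Lemma continuous_cons_l n (y : 'rV[R]_n) : continuous (fun t : R => cons_rV (t, y)).
Proof.
move=> t; apply: (cvg_rV (F := nbhs t)) => j; case: (unliftP ord0 j) => [k|] -> /=.
  by under eq_fun do rewrite cons_rVES; rewrite cons_rVES; exact: cvg_cst.
by under eq_fun do rewrite cons_rVE0; rewrite cons_rVE0; exact: cvg_id.
Qed.

Lemma continuous_cons_r n (t : R) : continuous (fun y : 'rV[R]_n => cons_rV (t, y)).
Proof.
move=> y; apply: (cvg_rV (F := nbhs y)) => j; case: (unliftP ord0 j) => [k|] -> /=.
  under eq_fun do rewrite cons_rVES; rewrite cons_rVES.
  exact: coord_continuous.
by under eq_fun do rewrite cons_rVE0; rewrite cons_rVE0; exact: cvg_cst.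
Qed.

Lemma partial0_cons n (g : 'rV[R]_n.+1 -> R) t y :
  derivable g (cons_rV (t, y)) (delta_mx ord0 ord0) ->
  is_derive t (1 : R) (fun s => g (cons_rV (s, y))) (partial ord0 g (cons_rV (t, y))).
Proof.
have E : (fun h : R => h^-1 *: (((fun s => g (cons_rV (s, y))) \o shift t) (h *: (1 : R)) - g (cons_rV (t, y)))) =
  (fun h : R => h^-1 *: ((g \o shift (cons_rV (t, y))) (h *: delta_mx ord0 ord0) - g (cons_rV (t, y)))).
  by apply/funext => h /=; rewrite cons_rV_shift0 [h *: 1]mulr1.
by move=> dg; apply: DeriveDef; rewrite /derivable /partial /derive E.
Qed.

Lemma derivable_cons_r n (g : 'rV[R]_n.+1 -> R) t y j :
  derivable g (cons_rV (t, y)) (delta_mx ord0 (lift ord0 j)) ->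
  derivable (fun z => g (cons_rV (t, z))) y (delta_mx ord0 j).
Proof.
rewrite /derivable; set F := fun h => _; set G := fun h => _.
suff -> : F = G by [].
by apply/funext => h; rewrite /F /G /= cons_rV_shiftS.
Qed.

Lemma partialS_cons n (g : 'rV[R]_n.+1 -> R) t y j :
  partial (lift ord0 j) g (cons_rV (t, y)) =
  partial j (fun z => g (cons_rV (t, z))) y.
Proof.
rewrite /partial /derive; set F := fun h => _; set G := fun h => _.
suff -> : F = G by [].
by apply/funext => h; rewrite /F /G /= cons_rV_shiftS.
Qed.

Lemma open_not_box n r : open (~` @box R n r).
Proof.
apply: closed_openC; apply: compact_closed_rV; exact: compact_box.
Qed.

Lemma FTC_compact (G dG : R -> R) (r : R) : continuous dG ->
  (forall t, is_derive t (1 : R) G (dG t)) -> (forall t, r < `|t| -> G t = 0) ->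
  (\int[@lebesgue_measure R]_t (dG t)%:E = 0)%E.
Proof.
move=> cdG dG' G0; pose s : R := `|r| + 1.
have s0 : 0 < s by rewrite ltr_wpDl.
have rs : r < s by rewrite ltr_pwDr// ler_norm.
have cG : continuous G.
  by move=> t; apply/differentiable_continuous/derivable1_diffP; have := dG' t.
have E : (\int[@lebesgue_measure R]_(t in `[(- s)%R, s]) (dG t)%:E = 0)%E.
  rewrite (@continuous_FTC2 _ dG G)//.
  - by rewrite !G0 ?subee// ?normrN gtr0_norm.
  - by rewrite -subr_gt0 opprK addr_gt0.
  - exact: continuous_subspaceT.
  - split.
    + by move=> t _; have := dG' t.
    + exact: cvg_at_right_filter (cG _).
    + exact: cvg_at_left_filter (cG _).
  - by move=> t _; rewrite derive1E; exact: (@derive_val _ _ _ _ _ _ _ (dG' t)).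
(* Off the interval [G] is locally [0], hence so is its derivative. *)
rewrite -[RHS]E [RHS]integral_mkcond; apply: eq_integral => t _.
rewrite patchE; case: ifPn => // /negP; rewrite inE /= in_itv/= -ler_norml => /negP.
rewrite -ltNge => ts; have := dG' t => -[_ <-].
have -> : 'D_1 G t = 'D_1 (cst 0 : R -> R) t; last by rewrite derive_cst.
apply: near_eq_derive; near=> u; apply: G0.
apply: lt_trans rs _; near: u.
have : {for t, continuous (fun u : R => `|u|)} by exact: norm_continuous.
by move=> /cvgr_gt; apply.
Unshelve. all: by end_near. Qed.

(** Fubini, in the order that makes the inner integral vanish: along the first coordinate by the
    fundamental theorem of calculus if that is the direction of differentiation, otherwise over the
    remaining coordinates by the induction hypothesis applied to slices. *)
Lemma integral_partial n (g : 'rV[R]_n -> R) i r :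
  (forall x, derivable g x (delta_mx ord0 i)) -> continuous (partial i g) ->
  (forall x, ~ box r x -> g x = 0) ->
  (\int[lebesgue_rV n]_x (partial i g x)%:E = 0)%E.
Proof.
elim: n g i => [g [//]|n IH g i dg cdg g0].
have dg0 x : ~ box r x -> partial i g x = 0.
  by move=> xr; apply: (partial_zero i (@open_not_box n.+1 r) g0).
have mf : measurable_fun setT (partial i g) by exact: continuous_measurable_rV.
have fi : (lebesgue_rV n.+1).-integrable setT (EFin \o partial i g).
  exact: integrable_continuous_box dg0.
rewrite (integral_cons mf fi); have fci := integrable_cons mf fi.
case: (unliftP ord0 i) => [j|] ij; rewrite {}ij in dg cdg dg0 mf fi fci *.
  rewrite -(integral12_prod_meas1 fci)/= integral0_eq// => t _.
  rewrite /fubini_F; under eq_integral do rewrite partialS_cons.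
  apply: IH => [y||y yr].
  - by apply: derivable_cons_r; exact: dg.
  - move=> y; rewrite (_ : partial _ _ = fun z => partial (lift ord0 j) g (cons_rV (t, z))).
      by apply: continuous_comp; [exact: continuous_cons_r|exact: cdg].
    by apply/funext => z; rewrite partialS_cons.
  - apply: g0 => cr; apply: yr => k.
    by have := cr (lift ord0 k); rewrite cons_rVES.
rewrite -(integral21_prod_meas1 fci)/= integral0_eq// => y _; rewrite /fubini_G.
apply: (@FTC_compact (fun t => g (cons_rV (t, y))) _ r).
- by move=> t; apply: continuous_comp; [exact: continuous_cons_l|exact: cdg].
- by move=> t; exact: partial0_cons.
- move=> t rt; apply: g0 => /(_ ord0); rewrite cons_rVE0 => /le_lt_trans/(_ rt).
  by rewrite ltxx.
Qed.

End integration_by_parts.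

(** * The ball model *)

Section ball.
Context {R : realType} {N : nat}.
Local Notation E := 'rV[R]_N.
Local Notation leb := (@lebesgue_rV R N).
Local Notation B := (@unit_ball R N).

Definition rho (x : E) : R := (1 - dotp x x) / 2.

Lemma dotp_ge0 (x : E) : 0 <= dotp x x.
Proof. by apply: sumr_ge0 => i _; rewrite -expr2 sqr_ge0. Qed.

Lemma enorm_sqr (x : E) : enorm x ^+ 2 = dotp x x.
Proof. by rewrite sqr_sqrtr// dotp_ge0. Qed.

Lemma dotp_rho (x : E) : dotp x x = 1 - 2 * rho x.
Proof. by rewrite /rho; field. Qed.

Lemma conformal_factorE (x : E) : conformal_factor x = (rho x)^-1.
Proof. by rewrite /conformal_factor enorm_sqr /rho invf_div. Qed.

Lemma unit_ballP (x : E) : B x <-> 0 < rho x.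
Proof.
rewrite /unit_ball /= /rho pmulr_lgt0 ?invr_gt0 ?ltr0n// subr_gt0 -enorm_sqr.
by rewrite expr_lt1// sqrtr_ge0.
Qed.

Lemma Ck_rho k (D : set E) : open D -> Ck k D rho.
Proof.
move=> oD; apply: (@Ck_eq _ _ _ _ (fun x : E => (1 + -1 * \sum_(i < N) x ord0 i * x ord0 i) * 2^-1)) => //.
  by move=> x _; rewrite /rho /dotp mulN1r.
apply: Ck_mul => //; last exact: Ck_cst.
apply: Ck_add => //; first exact: Ck_cst.
apply: Ck_mul => //; first exact: Ck_cst.
by apply: Ck_sum => // i; apply: Ck_mul => //; exact: Ck_coord.
Qed.

Lemma continuous_rho : continuous rho.
Proof. by move=> x; apply: (Ck_continuous (@Ck_rho 0 setT openT)). Qed.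

Lemma partial_rho i (x : E) : partial i rho x = - x ord0 i.
Proof.
have dc j : is_derive x (delta_mx ord0 i) (fun x : E => x ord0 j : R) (i == j)%:R.
  have := congr1 (fun f => f x) (@partial_coord R N i j) => /= <-.
  by apply: derivableP; exact/diff_derivable/differentiable_coord.
have dM j : is_derive x (delta_mx ord0 i) (fun x : E => x ord0 j * x ord0 j)
    (2 * ((i == j)%:R * x ord0 j)).
  have h := is_deriveM (dc j) (dc j).
  apply: is_derive_eq h _; rewrite /GRing.scale/=; ring.
have dS : is_derive x (delta_mx ord0 i) (\sum_(j < N) (fun x : E => x ord0 j * x ord0 j))
    (\sum_(j < N) (2 * ((i == j)%:R * x ord0 j))).
  exact: is_derive_sum.
have dR := is_deriveM (is_deriveD (is_derive_cst (1 : R) x (delta_mx ord0 i)) (is_deriveN dS))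
  (is_derive_cst (2^-1 : R) x (delta_mx ord0 i)).
have -> : rho = (cst 1 + - (\sum_(j < N) (fun x : E => x ord0 j * x ord0 j))) * cst 2^-1.
  by apply/funext => y; rewrite /rho /dotp /= fctE /= fct_sumE.
have S : \sum_(j < N) (2 * ((i == j)%:R * x ord0 j)) = 2 * x ord0 i.
  rewrite -mulr_sumr (bigD1 i)//= eqxx mul1r big1 ?addr0// => j ji.
  by rewrite eq_sym (negbTE ji) mul0r.
rewrite /partial (@derive_val _ _ _ _ _ _ _ dR) S.
by rewrite /GRing.scale/=; field.
Qed.

Lemma open_unit_ball : open B.
Proof.
rewrite (_ : B = rho @^-1` [set t | 0 < t]).
  by apply: open_comp => [x _|]; [exact: continuous_rho|exact: open_gt].
by apply/seteqP; split=> x /unit_ballP.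
Qed.

Lemma measurable_unit_ball : measurable B.
Proof. by apply: open_measurable_rV; exact: open_unit_ball. Qed.

Lemma ball_sub_box : B `<=` box 1.
Proof.
move=> x /unit_ballP; rewrite /rho pmulr_lgt0 ?invr_gt0 ?ltr0n// subr_gt0 => x1 j.
rewrite -(@ler_pXn2r _ 2) ?nnegrE// expr1n real_normK ?num_real//.
apply: le_trans (ltW x1); rewrite /dotp (bigD1 j)//= expr2 lerDl.
by apply: sumr_ge0 => i _; rewrite -expr2 sqr_ge0.
Qed.

Lemma lebesgue_ball_lty : (leb B < +oo)%E.
Proof.
have : (leb (@box R N 1) < +oo)%E by rewrite lebesgue_box ?ltry.
apply: le_lt_trans; apply: le_measure; rewrite ?inE.
- exact: measurable_unit_ball.
- exact: measurable_box.
- exact: ball_sub_box.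
Qed.

(** For [e] decreasing to [0] these sets exhaust the ball by compact subsets, on each of which the
    powers of [1 / rho] are bounded. *)
Definition core (e : R) : set E := [set x | e <= rho x].

Lemma compact_core e : 0 < e -> compact (core e).
Proof.
move=> e0; apply: (subclosed_compact _ (@compact_box R N 1)).
  apply: (@closed_comp _ _ rho [set t | e <= t]) => [x _|]; first exact: continuous_rho.
  exact: closed_ge.
by move=> x ex; apply/ball_sub_box/unit_ballP/(lt_le_trans e0).
Qed.

Lemma core_sub_ball e : 0 < e -> core e `<=` B.
Proof. by move=> e0 x ex; apply/unit_ballP/(lt_le_trans e0). Qed.

Definition csupp (f : E -> R) := exists K : set E,
  [/\ compact K, K `<=` B & forall x, ~ K x -> f x = 0].

Lemma csupp_mulr (f g : E -> R) : csupp f -> csupp (fun x => f x * g x).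
Proof. by move=> [K [cK KB f0]]; exists K; split=> // x /f0 ->; rewrite mul0r. Qed.

Lemma csupp_mull (f g : E -> R) : csupp g -> csupp (fun x => f x * g x).
Proof. by move=> [K [cK KB f0]]; exists K; split=> // x /f0 ->; rewrite mulr0. Qed.

Lemma csupp_partial (f : E -> R) i : csupp f -> csupp (partial i f).
Proof.
move=> [K [cK KB f0]]; exists K; split=> // x Kx.
by apply: partial_zero f0 Kx; apply: closed_openC; exact: compact_closed_rV.
Qed.

Lemma csupp_add (f g : E -> R) : csupp f -> csupp g -> csupp (fun x => f x + g x).
Proof.
move=> [K [cK KB f0]] [L [cL LB g0]]; exists (K `|` L); split.
- exact: compactU.
- by move=> x [/KB|/LB].
- by move=> x /not_orP[/f0 -> /g0 ->]; rewrite addr0.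
Qed.

Lemma csupp_out (f : E -> R) x : csupp f -> ~ B x -> f x = 0.
Proof. by move=> [K [cK KB f0]] Bx; apply: f0; apply: contra_not Bx; exact: KB. Qed.

(** The ball and the complement of the support are open, they cover the whole space, and the
    function is [0] on the second. Products with weights singular on the sphere can therefore be
    studied inside the ball only. *)
Lemma csupp_Ck k (f : E -> R) : csupp f -> Ck k B f -> Ck k setT f.
Proof.
move=> [K [cK KB f0]] cf.
have oK : open (~` K) by apply: closed_openC; exact: compact_closed_rV.
apply: (@Ck_sub _ _ _ (B `|` ~` K)).
  by move=> x _; have [Kx|Kx] := pselect (K x); [left; exact: KB|right].
by apply: Ck_setU => //; apply: Ck_zero.
Qed.

Lemma csupp_smooth (f : E -> R) : csupp f -> smooth_on B f -> test_function f.
Proof. by move=> sf cf; split=> // k; apply: csupp_Ck. Qed.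

Lemma test_csupp (f : E -> R) : test_function f -> csupp f.
Proof. by case. Qed.

Lemma test_Ck k (f : E -> R) (D : set E) : test_function f -> Ck k D f.
Proof. by move=> [sf _]; apply: (@Ck_sub _ _ _ setT). Qed.

Lemma csupp_integrable (f : E -> R) : csupp f -> Ck 0 B f ->
  leb.-integrable setT (EFin \o f).
Proof.
move=> sf cf; apply: (@integrable_continuous_box _ _ _ 1).
  by move=> x; apply: (Ck_continuous (csupp_Ck sf cf)).
move=> x bx; apply: csupp_out => //; apply: contra_not bx; exact: ball_sub_box.
Qed.

Lemma csupp_integrable_ball (f : E -> R) : csupp f -> Ck 0 B f ->
  leb.-integrable B (EFin \o f).
Proof.
move=> sf cf; apply: integrableS (csupp_integrable sf cf) => //.
exact: measurable_unit_ball.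
Qed.

Lemma integral_partial_ball (f : E -> R) i : csupp f -> Ck 1 B f ->
  \int[leb]_(x in B) partial i f x = 0.
Proof.
move=> sf /(csupp_Ck sf) cf.
rewrite Rintegral_mkcond (_ : _ \_ _ = partial i f); last first.
  apply/funext => x; rewrite patchE; case: ifPn => // /negP; rewrite inE => xB.
  by rewrite (csupp_out (csupp_partial i sf)).
rewrite /Rintegral (@integral_partial _ _ _ _ 1)//.
- by move=> x; exact: CkS_derivable cf _.
- by move=> x; exact: (Ck_continuous (CkS_partial i cf)).
- move=> x bx; apply: csupp_out => //; apply: contra_not bx; exact: ball_sub_box.
Qed.

End ball.

Lemma normrM_le_sqrD (R : realFieldType) (a b : R) : `|a * b| <= a ^+ 2 + b ^+ 2.
Proof.
rewrite ler_norml; have h1 := sqr_ge0 (a + b); have h2 := sqr_ge0 (a - b).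
have h3 := sqr_ge0 a; have h4 := sqr_ge0 b.
by apply/andP; split; nra.
Qed.

(** * Local integrability on the ball *)

Section local_integrability.
Context {R : realType} {N : nat}.
Local Notation E := 'rV[R]_N.
Local Notation leb := (@lebesgue_rV R N).
Local Notation B := (@unit_ball R N).

Definition locint (h : E -> R) := measurable_fun B h /\
  forall K : set E, compact K -> K `<=` B -> leb.-integrable K (EFin \o h).

Lemma Ck_measurable k (f : E -> R) : Ck k B f -> measurable_fun B f.
Proof.
move=> cf; apply: (measurability _ (measurable_realfun.RGenOpens.measurableE R)).
move=> _ [_ [a [b ->] <-]]; apply: open_measurable_rV.
rewrite openE => x [Bx fx]; apply: filterI.
  by apply: open_nbhs_nbhs; split => //; exact: open_unit_ball.
have /= := Ck_continuous cf Bx; apply.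
by apply: open_nbhs_nbhs; split => //; exact: interval_open.
Qed.

Lemma csupp_bounded (c : E -> R) : csupp c -> Ck 0 B c ->
  exists2 C : R, 0 < C & forall x, `|c x| <= C.
Proof.
move=> sc cc; have cT := csupp_Ck sc cc; case: sc => K [cK KB c0].
have [|C C0 HC] := compact_continuous_bounded cK (_ : continuous c).
  by move=> x; exact: Ck_continuous cT _.
exists C => // x; have [/HC//|/c0 ->] := pselect (K x).
by rewrite normr0 ltW.
Qed.

Lemma integrable_csuppM (c h : E -> R) : csupp c -> Ck 0 B c -> locint h ->
  leb.-integrable B (EFin \o (fun x => c x * h x)).
Proof.
move=> sc cc [mh ih]; have [C C0 HC] := csupp_bounded sc cc.
have [K [cK KB c0]] := sc.
have mK := compact_measurable_rV cK.
have mB := @measurable_unit_ball R N.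
have ihK : leb.-integrable B ((EFin \o (fun x => C * h x)) \_ K).
  apply: ((integrable_restrict leb mK mB (EFin \o (fun x => C * h x))).1 _).
  by rewrite setIidr//; apply: (integrableZl mK C (ih K cK KB)).
apply: le_integrable ihK => //.
  apply/measurable_EFinP; apply: measurable_funM => //.
  exact: Ck_measurable cc.
move=> x Bx; rewrite patchE; case: ifPn => xK /=.
  rewrite lee_fin !normrM (gtr0_norm C0) ler_wpM2r//; exact: HC.
by rewrite c0 ?mul0r ?normr0//; move/negP: xK; rewrite inE.
Qed.

Lemma L2loc_sqr (f : E -> R) : L2loc f -> locint (fun x => f x ^+ 2).
Proof.
move=> [mf Hf]; split; first exact: measurable_funX.
move=> K cK KB; apply/integrableP; split.
  by apply/measurable_EFinP; apply: measurable_funS (measurable_funX 2 mf) => //; exact: measurable_unit_ball.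
under eq_integral do rewrite /= ger0_norm ?sqr_ge0//.
exact: Hf.
Qed.

Lemma locint_le (f g : E -> R) : measurable_fun B f -> locint g ->
  (forall x, B x -> `|f x| <= `|g x|) -> locint f.
Proof.
move=> mf [mg ig] fg; split=> // K cK KB.
apply: le_integrable (ig K cK KB); first exact: compact_measurable_rV.
  by apply/measurable_EFinP; apply: measurable_funS mf => //; exact: measurable_unit_ball.
by move=> x Kx; rewrite lee_fin; apply/fg/KB.
Qed.

Lemma locintD (f g : E -> R) : locint f -> locint g -> locint (fun x => f x + g x).
Proof.
move=> [mf If] [mg Ig]; split; first exact: measurable_funD.
move=> K cK KB; apply: (integrableD (compact_measurable_rV cK) (If K cK KB) (Ig K cK KB)).
Qed.

Lemma locint_cst (r : R) : locint (cst r).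
Proof.
split; first exact: measurable_cst.
move=> K cK KB; apply: measurable_bounded_integrable.
- exact: compact_measurable_rV.
- apply: le_lt_trans (@lebesgue_ball_lty R N); apply: le_measure; rewrite ?inE//.
    exact: compact_measurable_rV.
  exact: measurable_unit_ball.
- exact: measurable_cst.
- exists `|r|; split; first by rewrite num_real.
  by move=> M rM x _; exact: ltW.
Qed.

Lemma L2loc_locint (f : E -> R) : L2loc f -> locint f.
Proof.
move=> Hf; apply: (locint_le _ (locintD (L2loc_sqr Hf) (locint_cst 1))).
  by case: Hf.
move=> x _ /=; rewrite [leRHS]ger0_norm ?addr_ge0 ?sqr_ge0//.
by have := normrM_le_sqrD (f x) 1; rewrite mulr1 expr1n.
Qed.

End local_integrability.

(** * Powers of the conformal factor as weights *)

Section weights.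
Context {R : realType} {N : nat}.
Local Notation E := 'rV[R]_N.
Local Notation leb := (@lebesgue_rV R N).
Local Notation B := (@unit_ball R N).
Implicit Types (f g : E -> R) (x : E).

Lemma partialM f g i x : derivable f x (delta_mx ord0 i) ->
  derivable g x (delta_mx ord0 i) ->
  partial i (fun y => f y * g y) x = f x * partial i g x + g x * partial i f x.
Proof. by move=> df dg; exact: (deriveM df dg). Qed.

Lemma partialX2 f i x : derivable f x (delta_mx ord0 i) ->
  partial i (fun y => f y ^+ 2) x = 2 * f x * partial i f x.
Proof.
move=> df; rewrite (_ : (fun y => f y ^+ 2) = fun y => f y * f y).
  by rewrite partialM//; ring.
by apply/funext => y; rewrite expr2.
Qed.

(* [rhoV N x dx] is the hyperbolic volume element. *)
Definition rhoV k x : R := (rho x)^-1 ^+ k.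

Lemma Ck_rhoV k n : Ck k B (rhoV n).
Proof.
have oB := @open_unit_ball R N.
apply: Ck_exp => //; apply: Ck_inv => //; last exact: Ck_rho.
by move=> x /unit_ballP r0; rewrite lt0r_neq0.
Qed.

Lemma rhoV_ge0 k x : B x -> 0 <= rhoV k x.
Proof. by move=> /unit_ballP r0; rewrite exprn_ge0// invr_ge0 ltW. Qed.

Lemma rho_rhoV k x : B x -> rho x * rhoV k.+1 x = rhoV k x.
Proof.
by move=> /unit_ballP r0; rewrite /rhoV exprS mulrA divff ?mul1r// lt0r_neq0.
Qed.

Lemma partial_inv_rho i x : B x ->
  partial i (fun y => (rho y)^-1) x = rhoV 2 x * x ord0 i.
Proof.
move=> Bx; have r0 := (unit_ballP x).1 Bx.
have dr := CkS_derivable (i := i) (@Ck_rho R N 1 setT openT) (I : setT x).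
rewrite /partial (deriveV (lt0r_neq0 r0) dr) -/(partial i rho x) partial_rho.
by rewrite /rhoV exprVn /GRing.scale/=; ring.
Qed.

Lemma partial_rhoV i k x : B x ->
  partial i (rhoV k) x = k%:R * rhoV k.+1 x * x ord0 i.
Proof.
move=> Bx; elim: k => [|k IH].
  rewrite (_ : rhoV 0 = cst 1); last by apply/funext => y; rewrite /rhoV expr0.
  by rewrite /partial derive_cst !mul0r.
rewrite (_ : rhoV k.+1 = fun y => rhoV 1 y * rhoV k y); last first.
  by apply/funext => y; rewrite /rhoV -exprD add1n.
have d n := CkS_derivable (i := i) (@Ck_rhoV 1 n) Bx.
rewrite partialM// IH (_ : rhoV 1 = fun y => (rho y)^-1); last first.
  by apply/funext => y; rewrite /rhoV expr1.
by rewrite partial_inv_rho// /rhoV !exprS -[k.+1]addn1 natrD; ring.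
Qed.

Lemma partial_coordE i x : partial i (fun y : E => y ord0 i) x = 1.
Proof. by have := congr1 (fun h => h x) (@partial_coord R N i i); rewrite /= eqxx. Qed.

Lemma gmetric_hgrad x (v w : E) : B x ->
  gmetric x (hgrad x v) (hgrad x w) = rho x ^+ 2 * dotp v w.
Proof.
move=> /unit_ballP r0; rewrite /gmetric /hgrad conformal_factorE.
have -> : dotp (((rho x)^-1 ^+ 2)^-1 *: v) (((rho x)^-1 ^+ 2)^-1 *: w) =
  (rho x ^+ 2) ^+ 2 * dotp v w.
  rewrite /dotp mulr_sumr; apply: eq_bigr => i _; rewrite !mxE exprVn invrK; ring.
by rewrite exprVn mulrA; congr (_ * _); field; rewrite lt0r_neq0.
Qed.

Lemma conformal_factor_exp k x : conformal_factor x ^+ k = rhoV k x.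
Proof. by rewrite conformal_factorE. Qed.

Lemma csupp_grad2 (f : E -> R) : csupp f -> csupp (fun x => dotp (grad f x) (grad f x)).
Proof.
move=> [K [cK KB f0]]; exists K; split=> // x Kx.
rewrite /dotp big1// => i _; rewrite mxE.
by rewrite (partial_zero i _ f0 Kx) ?mul0r//; apply: closed_openC; exact: compact_closed_rV.
Qed.

Lemma Ck_grad2 k (D : set E) (f : E -> R) : open D -> Ck k.+1 D f ->
  Ck k D (fun x => dotp (grad f x) (grad f x)).
Proof.
move=> oD cf.
apply: (@Ck_eq _ _ _ _ (fun x => \sum_(i < N) partial i f x * partial i f x)) => //.
  by move=> x _; apply: eq_bigr => i _; rewrite !mxE.
by apply: Ck_sum => // i; apply: Ck_mul => //; exact: CkS_partial.
Qed.

Lemma mass_integrable (f : E -> R) k : test_function f ->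
  leb.-integrable B (EFin \o (fun x => f x ^+ 2 * rhoV k x)).
Proof.
move=> tf; have oB := @open_unit_ball R N.
apply: csupp_integrable_ball.
  by under eq_fun do rewrite expr2; apply/csupp_mulr/csupp_mulr/test_csupp.
by apply: Ck_mul => //; [apply: Ck_exp => //; exact: test_Ck|exact: Ck_rhoV].
Qed.

End weights.

(** * A Hardy inequality *)

Section Hardy.
Context {R : realType} (m : nat).
Local Notation N := m.+1.
Local Notation E := 'rV[R]_N.
Local Notation leb := (@lebesgue_rV R N).
Local Notation B := (@unit_ball R N).

Lemma lambda1E : lambda1 N = (m%:R / 2) ^+ 2 :> R.
Proof. by rewrite /lambda1 -natr1; field. Qed.

(** [m / 2] times the divergence of this radial field supplies the cross term of the square in the
    Hardy inequality; the terms in [f ^ 2] then complete the square up to the remainder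
    [m / 2 * f ^ 2 * rho ^ - m]. *)
Let vfield (f : E -> R) i x := f x ^+ 2 * rhoV m x * x ord0 i.

Let Ck_vfield k f i : test_function f -> Ck k B (vfield f i).
Proof.
move=> tf; have oB := @open_unit_ball R N.
apply: Ck_mul => //; last exact: Ck_coord.
by apply: Ck_mul => //; [apply: Ck_exp => //; exact: test_Ck|exact: Ck_rhoV].
Qed.

Let csupp_vfield f i : test_function f -> csupp (vfield f i).
Proof.
move=> /test_csupp sf; apply: csupp_mulr; apply: csupp_mulr.
by under eq_fun do rewrite expr2; exact: csupp_mulr.
Qed.

Let energy (f : E -> R) x :=
  gmetric x (hgrad x (grad f x)) (hgrad x (grad f x)) - lambda1 N * f x ^+ 2.

(* The left side is [rhoV N x] times the square of the norm of
   [rho x *: grad f x + (m / 2 * f x) *: x], i.e. of the gradient of [f / rho ^ (m / 2)]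
   up to a weight. *)
Lemma Hardy_pointwise f x : test_function f -> B x ->
  0 <= energy f x * rhoV N x + m%:R / 2 * (\sum_(i < N) partial i (vfield f i) x)
       - m%:R / 2 * (f x ^+ 2 * rhoV m x).
Proof.
move=> tf Bx; have r0 := (unit_ballP x).1 Bx.
have df i := CkS_derivable (i := i) (test_Ck 1 B tf) Bx.
have df2 i := CkS_derivable (i := i) (Ck_exp 2 (@open_unit_ball R N) (test_Ck 1 B tf)) Bx.
have dW i := CkS_derivable (i := i) (@Ck_rhoV R N 1 m) Bx.
have dfW i : derivable (fun y => f y ^+ 2 * rhoV m y) x (delta_mx ord0 i).
  exact: derivableM (df2 i) (dW i).
have dc i := CkS_derivable (i := i) (@Ck_coord R N 1 B i) Bx.
have Vi i : partial i (vfield f i) x =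
    f x ^+ 2 * (m%:R * rhoV N x) * (x ord0 i * x ord0 i) + f x ^+ 2 * rhoV m x
    + 2 * f x * rhoV m x * (x ord0 i * partial i f x).
  rewrite /vfield partialM// partialM// partial_coordE partial_rhoV// partialX2//; ring.
under eq_bigr do rewrite Vi.
rewrite !big_split/= -!mulr_sumr sumr_const card_ord -/(dotp x x) dotp_rho.
rewrite /energy gmetric_hgrad// lambda1E -(rho_rhoV m Bx) -[_ *+ N]mulr_natl -[N%:R]natr1.
set q := \sum_(i < N) x ord0 i * partial i f x.
set p := dotp _ _; set r := rho x; set a := f x; set s : R := m%:R / 2.
have sq : 0 <= r ^+ 2 * p + 2 * s * a * r * q + s ^+ 2 * a ^+ 2 * (1 - 2 * r).
  have <- : \sum_(i < N) (r * partial i f x + s * a * x ord0 i) ^+ 2 =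
    r ^+ 2 * p + 2 * s * a * r * q + s ^+ 2 * a ^+ 2 * (1 - 2 * r).
    rewrite -dotp_rho /p /q /dotp !mulr_sumr -!big_split/=; apply: eq_bigr => i _.
    by rewrite !mxE; ring.
  by apply: sumr_ge0 => i _; exact: sqr_ge0.
have -> : m%:R = 2 * s by rewrite /s; field.
apply: le_trans (mulr_ge0 (rhoV_ge0 N Bx) sq) _.
by rewrite le_eqVlt; apply/orP; left; apply/eqP; field.
Qed.

Let energyE f x : B x -> energy f x * rhoV N x =
  rho x ^+ 2 * rhoV N x * dotp (grad f x) (grad f x) + - lambda1 N * rhoV N x * f x ^+ 2.
Proof. by move=> Bx; rewrite /energy gmetric_hgrad//; ring. Qed.

Let energy_integrable f : test_function f ->
  leb.-integrable B (EFin \o (fun x => energy f x * rhoV N x)).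
Proof.
move=> tf; have oB := @open_unit_ball R N; have mB := @measurable_unit_ball R N.
have : leb.-integrable B (EFin \o (fun x =>
    rho x ^+ 2 * rhoV N x * dotp (grad f x) (grad f x) + - lambda1 N * rhoV N x * f x ^+ 2)).
  apply: csupp_integrable_ball.
    apply: csupp_add; apply: csupp_mull; first exact/csupp_grad2/test_csupp.
    by under eq_fun do rewrite expr2; apply/csupp_mulr/test_csupp.
  apply: Ck_add => //; apply: Ck_mul => //.
  - by apply: Ck_mul => //; [apply: Ck_exp => //; exact: Ck_rho|exact: Ck_rhoV].
  - by apply: Ck_grad2 => //; exact: test_Ck.
  - by apply: Ck_mul => //; [exact: Ck_cst|exact: Ck_rhoV].
  - by apply: Ck_exp => //; exact: test_Ck.
apply: eq_integrable => // x; rewrite inE => Bx /=.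
by rewrite energyE.
Qed.

(** The number [n] of summands is kept apart from the dimension, with the directions listed by [c],
    so that the induction on [n] leaves the ball unchanged. *)
Lemma Rintegral_sum_partial n (f : 'I_n -> E -> R) (c : 'I_n -> 'I_N) :
  (forall i, csupp (f i)) -> (forall i, Ck 1 B (f i)) ->
  leb.-integrable B (EFin \o (fun x => \sum_(i < n) partial (c i) (f i) x)) /\
  \int[leb]_(x in B) (\sum_(i < n) partial (c i) (f i) x) = 0.
Proof.
have mB := @measurable_unit_ball R N.
elim: n f c => [|n IH] f c sf cf.
  under eq_fun do rewrite big_ord0.
  split; first by apply: (eq_integrable mB (cst 0%E)) => //; exact: integrable0.
  by rewrite Rintegral_cst// mul0r.
under eq_fun do rewrite big_ord_recl.
have [i1 i2] := IH (fun i => f (lift ord0 i)) (fun i => c (lift ord0 i)) (fun i => sf _) (fun i => cf _).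
have i0 : leb.-integrable B (EFin \o partial (c ord0) (f ord0)).
  apply: csupp_integrable_ball; first exact: csupp_partial.
  exact: CkS_partial.
split; first exact: (integrableD mB i0 i1).
by rewrite RintegralD// integral_partial_ball// add0r.
Qed.

Theorem Hardy f : test_function f ->
  m%:R / 2 * (\int[leb]_(x in B) (f x ^+ 2 * rhoV m x)) <=
  hintegral (fun x => gmetric x (hgrad x (grad f x)) (hgrad x (grad f x))
                      - lambda1 N * f x ^+ 2).
Proof.
move=> tf; have mB := @measurable_unit_ball R N.
have [iV IV] := @Rintegral_sum_partial N (vfield f) id
  (fun i => csupp_vfield i tf) (fun i => Ck_vfield 1 i tf).
have iE := energy_integrable tf; have iM := mass_integrable m tf.
have -> : hintegral (fun x => energy f x) = \int[leb]_(x in B) (energy f x * rhoV N x).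
  by apply: eq_Rintegral => x _; rewrite conformal_factor_exp.
have iV' := integrableZl mB (m%:R / 2) iV; have iM' := integrableZl mB (m%:R / 2) iM.
rewrite -subr_ge0 -RintegralZl//.
(* The divergence has integral [0] and can be added freely. *)
have -> : \int[leb]_(x in B) (energy f x * rhoV N x) =
  \int[leb]_(x in B) (energy f x * rhoV N x + m%:R / 2 * (\sum_(i < N) partial i (vfield f i) x)).
  by rewrite RintegralD// RintegralZl// IV mulr0 addr0.
rewrite -RintegralB//; last exact: (integrableD mB iE iV').
apply: Rintegral_ge0 => x Bx; exact: Hardy_pointwise.
Qed.

End Hardy.

(** * A weighted square integral bound on [calH1] *)

Section weighted_bound.
Context {R : realType} (m : nat).
Local Notation N := m.+1.
Local Notation E := 'rV[R]_N.
Local Notation leb := (@lebesgue_rV R N).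
Local Notation B := (@unit_ball R N).

Lemma test_functionB (f g : E -> R) : test_function f -> test_function g ->
  test_function (fun x => f x - g x).
Proof.
move=> tf tg; have oB := @open_unit_ball R N.
have E1 : (fun x => f x - g x) = (fun x => f x + -1 * g x).
  by apply/funext => x; rewrite mulN1r.
rewrite E1; apply: csupp_smooth.
  by apply: csupp_add; [exact: test_csupp|apply: csupp_mull; exact: test_csupp].
move=> k; apply: Ck_add => //; first exact: test_Ck.
by apply: Ck_mul => //; [exact: Ck_cst|exact: test_Ck].
Qed.

Lemma measurable_weighted (g : E -> R) k : measurable_fun B g ->
  measurable_fun B (fun x => (g x ^+ 2 * rhoV k x)%:E).
Proof.
move=> mg; apply/measurable_EFinP; apply: measurable_funM.
  exact: measurable_funX.
exact: (Ck_measurable (@Ck_rhoV R N 0 k)).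
Qed.

Lemma rhoV_le_core k (e : R) (x : E) : 0 < e -> core e x -> rhoV k x <= e^-1 ^+ k.
Proof.
move=> e0 ex; have x0 : 0 < rho x by apply: lt_le_trans ex.
by apply: lerXn2r; rewrite ?nnegrE ?invr_ge0 ?(ltW e0) ?(ltW x0)// lef_pV2 ?posrE.
Qed.

(** Hardy's inequality turns the Cauchy condition into a weighted L^2 bound on [f n - f n0], uniform
    over the ball. Only the passage from [f n] to [u] is local; there [n] may depend on [e], while
    the bound [C] does not. *)
Lemma calH1_core_bound (u : E -> R) : (0 < m)%N -> calH1 u ->
  exists C : R, forall e : R, 0 < e ->
    (\int[leb]_(x in core e) (u x ^+ 2 * rhoV m x)%:E <= C%:E)%E.
Proof.
move=> m0 [G [f [[[mu_ Lu] _ _] tf cauchy lim]]].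
have mB := @measurable_unit_ball R N.
have [n0 Hn0] := cauchy 1 ltr01.
pose A := \int[leb]_(x in B) (f n0 x ^+ 2 * rhoV m x).
have s0 : 0 < (m%:R / 2 : R) by rewrite divr_gt0 ?ltr0n.
(* [u] is split into [u - f n], [f n - f n0] and [f n0], and the square of a sum of three terms
   costs a factor [3]. The three bounds are [1] from the choice of [n], [2 / m] from Hardy's
   inequality for an energy at most [1], and the weighted norm [A] of the fixed [f n0]. *)
exists (3 * 1 + 3 * (2 / m%:R) + 3 * A) => e e0.
have cK := @compact_core R N e e0; have KB := @core_sub_ball R N e e0.
have mK := compact_measurable_rV cK.
have mfB g : measurable_fun B g -> measurable_fun (core e) g by move=> ?; apply: measurable_funS KB _.
have mf n : measurable_fun B (f n) by exact: Ck_measurable (test_Ck 0 B (tf n)).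
have [lim1 _] := lim _ cK KB.
have Ce : 0 < e ^+ m by rewrite exprn_gt0.
(* The precision [e ^ m] compensates the weight, which is at most [e ^ - m] on [core e]. *)
have [n /= nn0 Hn] : exists2 n, (n0 <= n)%N &
    (\int[leb]_(x in core e) ((f n x - u x) ^+ 2)%:E <= (e ^+ m)%:E)%E.
  have /fine_cvgP[fin /cvgrPdist_le/(_ _ Ce)[n1 _ Hn1]] := lim1.
  case: fin => n2 _ Hn2.
  pose n := (n0 + n1 + n2)%N; exists n; first by rewrite /n -addnA leq_addr.
  have h1 : (n1 <= n)%N by rewrite /n addnAC leq_addl.
  have h2 : (n2 <= n)%N by rewrite /n leq_addl.
  have := Hn1 n h1; have := Hn2 n h2 => /= h2' h1'.
  rewrite -(fineK h2') lee_fin; apply: le_trans h1'.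
  by rewrite /= sub0r normrN ler_norm.
have tdf := test_functionB (tf n) (tf n0).
have Bd : \int[leb]_(x in B) ((f n x - f n0 x) ^+ 2 * rhoV m x) <= 2 / m%:R.
  have := Hardy tdf; have := Hn0 n n0 nn0 (leqnn _).
  rewrite /norm_lambda1; set h := hintegral _ => h1 h2.
  have : h <= 1.
    (* [Num.sqrt] is [0] on negative numbers, so the bound on [norm_lambda1] yields one on [h] only
       after a case distinction on its sign. *)
    have [h0|/ltW h0] := leP h 0; first exact: le_trans ler01.
    by rewrite -(sqr_sqrtr h0) expr_le1 ?sqrtr_ge0// ltW.
  move=> /(le_trans h2); rewrite -ler_pdivlMl// => /le_trans; apply.
  by rewrite mulr1 invf_div.
have ge0_int (g : E -> R) : measurable_fun B g ->
  (\int[leb]_(x in core e) (g x ^+ 2 * rhoV m x)%:E <=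
   \int[leb]_(x in B) (g x ^+ 2 * rhoV m x)%:E)%E.
  move=> mg; apply: ge0_subset_integral => //; first exact: measurable_weighted.
  by move=> x Bx; rewrite lee_fin mulr_ge0 ?sqr_ge0 ?rhoV_ge0.
have int_test g : test_function g ->
  (\int[leb]_(x in B) (g x ^+ 2 * rhoV m x)%:E = (\int[leb]_(x in B) (g x ^+ 2 * rhoV m x))%:E)%E.
  move=> tg; rewrite fineK//; apply: integrable_fin_num => //; exact: mass_integrable.
pose F1 x : \bar R := (3 * e^-1 ^+ m * (f n x - u x) ^+ 2)%:E.
pose F2 x : \bar R := (3 * ((f n x - f n0 x) ^+ 2 * rhoV m x))%:E.
pose F3 x : \bar R := (3 * (f n0 x ^+ 2 * rhoV m x))%:E.
have mF1 : measurable_fun (core e) F1.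
  apply/measurable_EFinP; apply: mfB; apply: measurable_funM => //.
  by apply: measurable_funX; apply: measurable_funB.
have mF2 : measurable_fun (core e) F2.
  apply/measurable_EFinP; apply: mfB; apply: measurable_funM => //.
  by apply/measurable_EFinP; exact: (@measurable_weighted (fun x => f n x - f n0 x) m (measurable_funB (mf n) (mf n0))).
have mF3 : measurable_fun (core e) F3.
  apply/measurable_EFinP; apply: mfB; apply: measurable_funM => //.
  by apply/measurable_EFinP; apply: measurable_weighted.
have F10 x : core e x -> (0 <= F1 x)%E.
  by move=> _; rewrite lee_fin mulr_ge0 ?sqr_ge0// mulr_ge0// exprn_ge0// invr_ge0 ltW.
have F20 x : core e x -> (0 <= F2 x)%E.
  by move=> /KB Bx; rewrite lee_fin mulr_ge0// mulr_ge0 ?sqr_ge0 ?rhoV_ge0.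
have F30 x : core e x -> (0 <= F3 x)%E.
  by move=> /KB Bx; rewrite lee_fin mulr_ge0// mulr_ge0 ?sqr_ge0 ?rhoV_ge0.
have F120 x : core e x -> (0 <= F1 x + F2 x)%E by move=> ex; rewrite adde_ge0 ?F10 ?F20.
apply: (@le_trans _ _ (\int[leb]_(x in core e) (F1 x + F2 x + F3 x))%E).
  apply: ge0_le_integral => //.
  - by move=> x /KB Bx; rewrite lee_fin mulr_ge0 ?sqr_ge0 ?rhoV_ge0.
  - by apply: measurable_funS KB _ => //; exact: measurable_weighted.
  - by apply: emeasurable_funD => //; exact: emeasurable_funD.
  move=> x ex; rewrite -!EFinD lee_fin.
  have W0 := rhoV_ge0 m (KB x ex); have W1 := rhoV_le_core m e0 ex.
  have sq0 := sqr_ge0 (f n x - u x).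
  have step : u x ^+ 2 <= 3 * (f n x - u x) ^+ 2 + 3 * (f n x - f n0 x) ^+ 2 + 3 * f n0 x ^+ 2.
    have := sqr_ge0 ((f n x - u x) + (f n x - f n0 x)).
    have := sqr_ge0 ((f n x - u x) + f n0 x).
    have := sqr_ge0 ((f n x - f n0 x) - f n0 x).
    move: (u x) (f n x) (f n0 x) => a b c h1 h2 h3; nra.
  apply: le_trans (ler_wpM2r W0 step) _.
  have key := ler_wpM2l sq0 W1.
  rewrite -subr_ge0; set a := (f n x - u x) ^+ 2 in key *.
  rewrite (_ : _ - _ = 3 * (a * e^-1 ^+ m - a * rhoV m x)); last by ring.
  by rewrite mulr_ge0// subr_ge0.
rewrite ge0_integralD// ?ge0_integralD//; last exact: emeasurable_funD.
rewrite !EFinD; apply: leeD; first apply: leeD.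
- rewrite /F1; under eq_integral do rewrite EFinM.
  rewrite ge0_integralZl_EFin//.
  + apply: (@le_trans _ _ ((3 * e^-1 ^+ m)%:E * (e ^+ m)%:E)%E).
      apply: lee_wpmul2l => //.
      by rewrite lee_fin mulr_ge0// exprn_ge0// invr_ge0 ltW.
    by rewrite -EFinM lee_fin -mulrA -exprMn mulVf ?expr1n// lt0r_neq0.
  + by move=> x _; rewrite lee_fin sqr_ge0.
  + by apply/measurable_EFinP; apply: mfB; apply: measurable_funX; exact: measurable_funB.
  + by rewrite mulr_ge0// exprn_ge0// invr_ge0 ltW.
- rewrite /F2; under eq_integral do rewrite EFinM.
  rewrite ge0_integralZl_EFin//.
  + rewrite [leRHS]EFinM; apply: lee_wpmul2l => //.
    apply: le_trans (ge0_int _ (measurable_funB (mf n) (mf n0))) _.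
    by rewrite int_test// lee_fin.
  + by move=> x /KB Bx; rewrite lee_fin mulr_ge0 ?sqr_ge0 ?rhoV_ge0.
  + apply: measurable_funS KB _ => //; apply: measurable_weighted; exact: measurable_funB.
- rewrite /F3; under eq_integral do rewrite EFinM.
  rewrite ge0_integralZl_EFin//.
  + rewrite [leRHS]EFinM; apply: lee_wpmul2l => //.
    by apply: le_trans (ge0_int _ (mf n0)) _; rewrite int_test.
  + by move=> x /KB Bx; rewrite lee_fin mulr_ge0 ?sqr_ge0 ?rhoV_ge0.
  + by apply: measurable_funS KB _ => //; exact: measurable_weighted.
Qed.

Lemma ball_core : B = \bigcup_(k in [set: nat]) core (k.+1%:R^-1 : R).
Proof.
apply/seteqP; split=> [x /unit_ballP x0|x [k _]]; last by apply: core_sub_ball; rewrite invr_gt0.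
have /cvgrPdist_lt/(_ (rho x) x0)[k _ /(_ k (leqnn _))] := @cvg_harmonic R.
rewrite /= sub0r normrN ger0_norm ?invr_ge0// => /ltW h.
by exists k.
Qed.

(** Monotone convergence along the cores. As [rhoV m x dx] is [rho dV], this is the finiteness of
    the integral of [u ^ 2 * rho] for the hyperbolic volume. *)
Lemma calH1_weighted_integrable (u : E -> R) : (0 < m)%N -> calH1 u ->
  leb.-integrable B (EFin \o (fun x => u x ^+ 2 * rhoV m x)).
Proof.
move=> m0 cu; have [C HC] := calH1_core_bound m0 cu.
have mu_ : measurable_fun B u by case: cu => G [f [[[]]]].
apply/integrableP; split; first exact: measurable_weighted.
rewrite (@le_lt_trans _ _ C%:E) ?ltry//.
under eq_integral => x xB.
  rewrite /= ger0_norm; last by rewrite mulr_ge0 ?sqr_ge0 ?rhoV_ge0//; exact: set_mem.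
  over.
have k0 k : 0 < (k.+1%:R^-1 : R) by rewrite invr_gt0.
have mU : forall k : nat, measurable (core (k.+1%:R^-1) : set E).
  by move=> k; apply: compact_measurable_rV; exact: compact_core.
rewrite ball_core.
apply: (cvge_le _ (@ge0_nondecreasing_set_cvg_integral _ _ _
  (fun k : nat => core (k.+1%:R^-1) : set E) (fun x => (u x ^+ 2 * rhoV m x)%:E) leb _ mU _ _)).
- by apply: nearW => k; exact: HC.
- move=> i j ij; rewrite subsetEset => x; apply: le_trans.
  by rewrite lef_pV2 ?posrE// ler_nat.
- move=> k; apply: (measurable_funS measurable_unit_ball _ (measurable_weighted m mu_)).
  exact: core_sub_ball.
- by move=> k x /(core_sub_ball (k0 k)) Bx; rewrite lee_fin mulr_ge0 ?sqr_ge0 ?rhoV_ge0.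
Qed.

End weighted_bound.

(** * Testing the equation with phi ^ 2 / u *)

Section convergence.
Context d (T : measurableType d) (R : realType).
Context (mu : {measure set T -> \bar R}) (D : set T).

Lemma L2_ae_subsequence (g : nat -> T -> R) : measurable D ->
  (forall n, measurable_fun D (g n)) ->
  (fun n => \int[mu]_(x in D) ((g n x) ^+ 2)%:E)%E @ \oo --> 0%E ->
  exists2 s : nat -> nat, (forall k, (k <= s k)%N) &
    {ae mu, forall x, D x -> (fun k => g (s k) x) @ \oo --> 0}.
Proof.
move=> mD mg g0.
have sP k : exists n, (k <= n)%N /\
    (\int[mu]_(x in D) ((g n x) ^+ 2)%:E <= (2^-1 ^+ k)%:E)%E.
  have ek : 0 < (2^-1 ^+ k : R) by rewrite exprn_gt0.
  have /fine_cvgP[[n2 _ fin] /cvgrPdist_le/(_ _ ek)[n1 _ Hn1]] := g0.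
  exists (k + n1 + n2)%N; split; first by rewrite -addnA leq_addr.
  have h1 : (n1 <= k + n1 + n2)%N by rewrite addnAC leq_addl.
  have h2 : (n2 <= k + n1 + n2)%N by rewrite leq_addl.
  have := Hn1 _ h1; have := fin _ h2 => /= h2' h1'.
  rewrite -(fineK h2') lee_fin; apply: le_trans h1'.
  by rewrite /= sub0r normrN ler_norm.
pose s k := sval (cid (sP k)).
have s1 k : (k <= s k)%N by rewrite /s; case: cid => n /= [].
have s2 k : (\int[mu]_(x in D) ((g (s k) x) ^+ 2)%:E <= (2^-1 ^+ k)%:E)%E.
  by rewrite /s; case: cid => n /= [].
exists s => //.
have mg2 k : measurable_fun D (fun x => ((g (s k) x) ^+ 2)%:E).
  by apply/measurable_EFinP; exact: measurable_funX.
have g20 k x : D x -> (0 <= ((g (s k) x) ^+ 2)%:E)%E by rewrite lee_fin sqr_ge0.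
have geo : (\sum_(k <oo) ((2^-1 ^+ k)%:E : \bar R) < +oo)%E.
  have := @cvg_geometric_series R 1 2^-1.
  rewrite ger0_norm// invf_lt1// ltr1n => /(_ isT) h.
  have <- : ((1 * (1 - 2^-1)^-1)%:E : \bar R) = (\sum_(k <oo) ((2^-1 ^+ k)%:E : \bar R))%E.
    apply/esym/cvg_lim => //.
    rewrite (_ : (fun n => _) = EFin \o series (geometric 1 2^-1)).
      by apply: cvg_EFin => //; exact: nearW.
    apply/funext => n; rewrite /= sumEFin /series/=; congr EFin.
    by apply: eq_bigr => i _; rewrite mul1r.
  by rewrite ltry.
have fin : mu.-integrable D (fun x => \sum_(k <oo) ((g (s k) x) ^+ 2)%:E)%E.
  apply/integrableP; split.
    by apply: ge0_emeasurable_sum => // k x Dx _; exact: g20.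
  under eq_integral => x xD.
    rewrite gee0_abs; last by apply: nneseries_ge0 => k _ _; apply: g20; exact: set_mem.
    over.
  rewrite integral_nneseries//; apply: le_lt_trans geo; apply: lee_nneseries => // k _.
  by move=> _; apply: integral_ge0; exact: g20.
have := integrable_ae mD fin; apply: filterS => x Hx Dx.
have cs : cvgn (series (fun k => g (s k) x ^+ 2)).
  apply: nondecreasing_is_cvgn.
    apply/nondecreasing_seqP => n.
    by rewrite /series/= big_nat_recr//= lerDl sqr_ge0.
  exists (fine (\sum_(k <oo) ((g (s k) x) ^+ 2)%:E)%E) => _ [n _ <-].
  rewrite -lee_fin fineK//; last exact: Hx.
  rewrite /series/= -sumEFin; apply: nneseries_lim_ge => k _ _; exact: g20.
have /cvgr0Pnorm_le c0 := cvg_series_cvg_0 cs.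
apply/cvgr0Pnorm_le => e e0.
have := c0 (e ^+ 2) (exprn_gt0 _ e0); apply: filterS => k.
by rewrite normrX ler_pXn2r// nnegrE// ltW.
Qed.

(** Dominated convergence with bound [C * |a|]. Convergence is asked only where [a] is nonzero
    because the approximants of [u] are controlled only on the compact support of the cutoff. *)
Lemma cvg_Rintegral_mul (a psi : T -> R) (phi : nat -> T -> R) (C : R) :
  measurable D -> mu.-integrable D (EFin \o a) ->
  (forall n, measurable_fun D (phi n)) -> measurable_fun D psi ->
  {ae mu, forall x, D x -> a x != 0 -> (fun n => phi n x) @ \oo --> psi x} ->
  (forall n x, D x -> `|phi n x| <= C) ->
  mu.-integrable D (EFin \o (fun x => a x * psi x)) /\
  (fun n => \int[mu]_(x in D) (a x * phi n x)) @ \oo -->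
    \int[mu]_(x in D) (a x * psi x).
Proof.
move=> mD ia mphi mpsi cphi bphi.
have ma : measurable_fun D a by apply/measurable_EFinP; exact: measurable_int ia.
have ig : mu.-integrable D (fun x => (C%:E * `|(a x)%:E|)%E).
  by apply: integrableZl => //; exact: integrable_abse ia.
have [] := @dominated_convergence _ _ _ mu D mD
  (fun n x => (a x * phi n x)%:E) (fun x => (a x * psi x)%:E) _ _ _ _ ig.
- by move=> n; apply/measurable_EFinP; exact: measurable_funM.
- by apply/measurable_EFinP; exact: measurable_funM.
- apply: filterS cphi => x Hx Dx; apply: cvg_EFin; first exact: nearW.
  have [a0|a0] := eqVneq (a x) 0.
    by rewrite a0 mul0r; under eq_fun do rewrite mul0r; exact: cvg_cst.
  by apply: cvgMr; exact: Hx.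
- apply: aeW => x n Dx; rewrite -EFinM lee_fin normrM mulrC ler_wpM2r//; exact: bphi.
move=> i1 _ c1; split=> //.
have i1f := integrable_fin_num mD i1.
by apply: fine_cvg; rewrite fineK.
Qed.

End convergence.

(** * A regularised reciprocal *)

Section smooth_inverse.
Context {R : realType}.
Implicit Types eta t : R.

(* A bounded smooth substitute for [1 / t] on [t > 0] with [g' <= - 3/4 g ^ 2]. *)
Definition sinv eta t := (t + 2 * eta) * ((t + 2 * eta) ^+ 2 + eta ^+ 2)^-1.
Definition dsinv eta t :=
  (eta ^+ 2 - (t + 2 * eta) ^+ 2) * ((t + 2 * eta) ^+ 2 + eta ^+ 2)^-1 ^+ 2.

Lemma sinv_den_gt0 eta t : 0 < eta -> 0 < (t + 2 * eta) ^+ 2 + eta ^+ 2.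
Proof. by move=> e0; rewrite ltr_wpDl ?sqr_ge0// exprn_gt0. Qed.

Lemma is_derive_sinv eta t : 0 < eta -> is_derive t (1 : R) (sinv eta) (dsinv eta t).
Proof.
move=> e0; have d0 := sinv_den_gt0 t e0.
have d1 := is_deriveD (is_derive_id t (1 : R)) (is_derive_cst (2 * eta) t (1 : R)).
have d2 := is_deriveD (is_deriveM d1 d1) (is_derive_cst (eta ^+ 2) t (1 : R)).
have n0 : ((id + cst (2 * eta)) * (id + cst (2 * eta)) + cst (eta ^+ 2) : R -> R) t != 0.
  by apply: lt0r_neq0; move: d0; rewrite expr2.
have d3 := is_deriveM d1 (is_deriveV n0 d2).
rewrite (_ : sinv eta = (id + cst (2 * eta)) *
   (fun y => (((id + cst (2 * eta)) * (id + cst (2 * eta)) + cst (eta ^+ 2) : R -> R) y)^-1)); last first.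
  by apply/funext => y; rewrite /sinv expr2.
apply: is_derive_eq d3 _.
rewrite /dsinv /GRing.scale/= [in RHS]expr2 !fctE/=.
by field; move: d0; rewrite expr2 => /lt0r_neq0.
Qed.

Lemma Ck_sinv n k (D : set 'rV[R]_n) f eta : open D -> 0 < eta -> Ck k D f ->
  Ck k D (fun x => sinv eta (f x)).
Proof.
move=> oD e0 cf; have c1 := Ck_add oD cf (Ck_cst k D (2 * eta)).
apply: Ck_mul => //; apply: Ck_inv => //.
  by move=> x _; rewrite lt0r_neq0// sinv_den_gt0.
by apply: Ck_add => //; [exact: Ck_exp|exact: Ck_cst].
Qed.

Lemma continuous_sinv eta : 0 < eta -> continuous (sinv eta).
Proof.
move=> e0 t; apply/differentiable_continuous/derivable1_diffP.
exact: (@ex_derive _ _ _ _ _ _ _ (is_derive_sinv t e0)).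
Qed.

Lemma continuous_dsinv eta : 0 < eta -> continuous (dsinv eta).
Proof.
move=> e0 t; rewrite (_ : dsinv eta = fun t => (eta ^+ 2 - (t + 2 * eta) * (t + 2 * eta)) *
  (((t + 2 * eta) * (t + 2 * eta) + eta ^+ 2)^-1 * ((t + 2 * eta) * (t + 2 * eta) + eta ^+ 2)^-1)); last first.
  by apply/funext => y; rewrite /dsinv !expr2.
have c0 : {for t, continuous (fun t : R => t + 2 * eta)}.
  by apply: cvgD; [exact: cvg_id|exact: cvg_cst].
have c1 : {for t, continuous (fun t : R => (t + 2 * eta) * (t + 2 * eta))}.
  exact: (continuousM c0 c0).
have c2 : {for t, continuous (fun t : R => ((t + 2 * eta) * (t + 2 * eta) + eta ^+ 2)^-1)}.
  apply: continuousV; first by rewrite -expr2 lt0r_neq0// sinv_den_gt0.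
  by apply: cvgD => //; exact: cvg_cst.
apply: (continuousM _ (continuousM c2 c2)).
by apply: cvgB => //; exact: cvg_cst.
Qed.

(** Valid for [t] of any sign, as the approximants of [u] require: the term [eta ^ 2] keeps the
    denominator away from [0], and [|y| * eta <= y ^ 2 + eta ^ 2] for [y = t + 2 * eta]. *)
Lemma sinv_bound eta t : 0 < eta -> `|sinv eta t| <= eta^-1.
Proof.
move=> e0; have d0 := sinv_den_gt0 t e0; rewrite /sinv normrM normfV (gtr0_norm d0).
rewrite ler_pdivrMr// ler_pdivlMl//; set y := t + 2 * eta.
rewrite -[y ^+ 2]real_normK ?num_real//.
have := sqr_ge0 (`|y| - eta); have := sqr_ge0 `|y|; have := sqr_ge0 eta.
have := normr_ge0 y; move: (`|y|) => z; nra.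
Qed.

Lemma dsinv_bound eta t : 0 < eta -> `|dsinv eta t| <= eta^-1 ^+ 2.
Proof.
move=> e0; have d0 := sinv_den_gt0 t e0; rewrite /dsinv normrM.
set y := t + 2 * eta in d0 *; set q := y ^+ 2 + eta ^+ 2 in d0 *.
rewrite [`|_^-1 ^+ 2|]ger0_norm; last by rewrite exprn_ge0// invr_ge0 ltW.
have h1 : `|eta ^+ 2 - y ^+ 2| <= q.
  by rewrite ler_norml /q; have := sqr_ge0 y; have := sqr_ge0 eta => ? ?; apply/andP; split; lra.
apply: le_trans (ler_wpM2r _ h1) _; first by rewrite exprn_ge0// invr_ge0 ltW.
rewrite expr2 mulrA divff ?mul1r ?lt0r_neq0// exprVn lef_pV2 ?posrE ?exprn_gt0//.
by rewrite /q lerDr sqr_ge0.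
Qed.

Lemma sinv_ge0 eta t : 0 < eta -> 0 <= t -> 0 <= sinv eta t.
Proof.
move=> e0 t0; rewrite /sinv mulr_ge0 ?invr_ge0//; last exact/ltW/sinv_den_gt0.
by rewrite addr_ge0// mulr_ge0// ltW.
Qed.

Lemma mul_sinv_le1 eta t : 0 < eta -> 0 <= t -> t * sinv eta t <= 1.
Proof.
move=> e0 t0; rewrite /sinv mulrA ler_pdivrMr ?sinv_den_gt0// mul1r; nra.
Qed.

(** The shift by [2 * eta] serves this bound: [y = t + 2 * eta >= 2 * eta] gives
    [eta ^ 2 <= y ^ 2 / 4], so the numerator of [dsinv] is at most [- 3/4 * y ^ 2]. *)
Lemma dsinv_le eta t : 0 < eta -> 0 <= t -> dsinv eta t <= - (3 / 4 * sinv eta t ^+ 2).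
Proof.
move=> e0 t0; rewrite /dsinv /sinv; have w0 := sinv_den_gt0 t e0; rewrite -invr_gt0 in w0.
set w := ((t + 2 * eta) ^+ 2 + eta ^+ 2)^-1 in w0 *.
rewrite [leRHS](_ : _ = - (3 / 4 * (t + 2 * eta) ^+ 2) * w ^+ 2); last by field.
by apply: ler_wpM2r; [rewrite exprn_ge0// ltW|nra].
Qed.

Lemma cvg_mul_sinv t : 0 < t -> (fun k : nat => t * sinv (k.+1%:R^-1) t) @ \oo --> (1 : R).
Proof.
move=> t0.
have c : (fun k : nat => 2 * k.+1%:R^-1 : R) @ \oo --> (2 * 0 : R) by apply: cvgMr; exact: cvg_harmonic.
rewrite [X in _ --> X](_ : _ = t * ((t + 2 * 0) * ((t + 2 * 0) ^+ 2 + 0 ^+ 2)^-1)); last first.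
  by rewrite expr0n/= !mulr0 !addr0; field; rewrite lt0r_neq0.
have c1 : (fun k : nat => t + 2 * k.+1%:R^-1 : R) @ \oo --> t + 2 * 0.
  by apply: cvgD => //; exact: cvg_cst.
apply: cvgMr; apply: cvgM => //; apply: cvgV.
  by rewrite mulr0 expr0n/= !addr0 lt0r_neq0// exprn_gt0.
by apply: cvgD; rewrite !expr2; apply: cvgM => //; exact: cvg_harmonic.
Qed.

End smooth_inverse.

Section ae_lemmas.
Context d (T : measurableType d) (R : realType).
Context (mu : {measure set T -> \bar R}) (D : set T).

Lemma ae_eq_integrable (f g : T -> R) : measurable D -> measurable_fun D g ->
  {ae mu, forall x, D x -> f x = g x} ->
  mu.-integrable D (EFin \o f) -> mu.-integrable D (EFin \o g).
Proof.
move=> mD mg fg fi; have mf := measurable_int _ fi.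
apply/integrableP; split; first exact/measurable_EFinP.
move/integrableP : fi => [_]; apply: le_lt_trans.
apply: ae_ge0_le_integral => //.
- by apply: measurableT_comp => //; exact/measurable_EFinP.
- exact: measurableT_comp.
- by apply: filterS fg => x /[swap] Dx /(_ Dx) /= ->.
Qed.

Lemma ae_eq_Rintegral (f g : T -> R) : measurable D -> measurable_fun D f -> measurable_fun D g ->
  {ae mu, forall x, D x -> f x = g x} ->
  \int[mu]_(x in D) f x = \int[mu]_(x in D) g x.
Proof.
move=> mD mf mg fg; congr fine; apply: ae_eq_integral => //.
- exact/measurable_EFinP.
- exact/measurable_EFinP.
- by apply: filterS fg => x /[swap] Dx /(_ Dx) /= ->.
Qed.

Lemma Rintegral_sum n (f : 'I_n -> T -> R) : measurable D ->
  (forall i, mu.-integrable D (EFin \o f i)) ->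
  mu.-integrable D (EFin \o (fun x => \sum_(i < n) f i x)) /\
  \int[mu]_(x in D) (\sum_(i < n) f i x) = \sum_(i < n) \int[mu]_(x in D) f i x.
Proof.
move=> mD; elim: n f => [|n IH] f fi.
  under eq_fun do rewrite big_ord0; rewrite big_ord0.
  split; first by apply: (eq_integrable mD (cst 0%E)) => //; exact: integrable0.
  by rewrite Rintegral_cst// mul0r.
under eq_fun do rewrite big_ord_recl; rewrite big_ord_recl.
have [i1 i2] := IH (fun i => f (lift ord0 i)) (fun i => fi _).
split; first exact: (integrableD mD (fi ord0) i1).
by rewrite RintegralD// i2.
Qed.

End ae_lemmas.

(** * The nonlinearity *)

Section nonlinearity.
Context {R : realType}.
Implicit Types lam p theta L t : R.

Definition nonlin lam p theta t := lam * t + theta * (t * ln (t ^+ 2)) + `|t| `^ (p - 1) * t.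

Lemma measurable_nonlin lam p theta : measurable_fun setT (nonlin lam p theta).
Proof.
apply: measurable_funD; first apply: measurable_funD.
- by apply: measurable_funM.
- apply: measurable_funM => //; apply: measurable_funM => //.
  by apply: measurableT_comp => //; exact: measurable_funX.
- apply: measurable_funM => //.
  by apply: (measurableT_comp (measurable_powR (p - 1))).
Qed.

(* [ln z <= z - 1] at [z = t * expR L]; [L] is free, so the linear coefficient is as
   large as we please. *)
Lemma nonlin_ge lam p theta L t : theta < 0 -> 0 < t ->
  (lam - 2 * theta * (L + 1)) * t - (- 2 * theta * expR L) * t ^+ 2
  <= nonlin lam p theta t.
Proof.
move=> th0 t0; rewrite /nonlin lnXn// -mulr_natl.
have h := expR_ge1Dx (ln t + L); rewrite expRD lnK ?posrE// in h.
have h1 : 0 <= `|t| `^ (p - 1) * t by rewrite mulr_ge0 ?powR_ge0 ?ltW.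
have h2 : theta * t <= 0 by rewrite mulr_le0_ge0 ?ltW.
have := ler_wnM2l h2 h; move: (ln t) (expR L) (`|t| `^ (p - 1) * t) h1 => a b c h1 h3.
rewrite -subr_ge0 (_ : _ - _ = 2 * (theta * t * (1 + (a + L)) - theta * t * (t * b)) + c); last by ring.
by rewrite addr_ge0// mulr_ge0// subr_ge0.
Qed.

End nonlinearity.

(** * The weak formulation for a chosen gradient and representative *)

Section weak_identity.
Context {R : realType} {N : nat}.
Local Notation E := 'rV[R]_N.
Local Notation leb := (@lebesgue_rV R N).
Local Notation B := (@unit_ball R N).

(* [\sum_i dweight psi i x * G x ord0 i] is the hyperbolic Dirichlet integrand of [psi]
   and a function with Euclidean gradient [G], with respect to [dx]. *)
Definition dweight (psi : E -> R) i x := rho x ^+ 2 * rhoV N x * partial i psi x.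

Lemma dweight_csupp (psi : E -> R) i : csupp psi -> csupp (dweight psi i).
Proof. by move=> sp; apply: csupp_mull; exact: csupp_partial. Qed.

Lemma dweight_Ck k (psi : E -> R) i : Ck k.+1 B psi -> Ck k B (dweight psi i).
Proof.
move=> cp; have oB := @open_unit_ball R N.
apply: Ck_mul => //; last exact: CkS_partial.
by apply: Ck_mul => //; [apply: Ck_exp => //; exact: Ck_rho|exact: Ck_rhoV].
Qed.

Lemma dweight_test (psi : E -> R) i : test_function psi -> test_function (dweight psi i).
Proof.
move=> tp; apply: csupp_smooth; first exact/dweight_csupp/test_csupp.
by move=> k; apply: dweight_Ck; exact: test_Ck.
Qed.

(** The weights are smooth inside the ball, so each [dweight psi i] is itself a test function and
    the derivative can be moved onto it. The resulting value depends on [u] alone, not on [G]. *)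
Lemma weak_gradient_pairing (u : E -> R) (G : E -> E) (psi : E -> R) :
  weak_gradient u G -> test_function psi ->
  leb.-integrable B (EFin \o (fun x => \sum_(i < N) dweight psi i x * G x ord0 i)) /\
  \int[leb]_(x in B) (\sum_(i < N) dweight psi i x * G x ord0 i) =
  \sum_(i < N) - \int[leb]_(x in B) (u x * partial i (dweight psi i) x).
Proof.
move=> [Lu LG wG] tp; have mB := @measurable_unit_ball R N.
have [|i1 i2] := @Rintegral_sum _ _ _ leb B N (fun i x => dweight psi i x * G x ord0 i) mB.
  move=> i; apply: integrable_csuppM; last exact/L2loc_locint.
    exact/dweight_csupp/test_csupp.
  by apply: dweight_Ck; exact: test_Ck.
split=> //; rewrite i2; apply: eq_bigr => i _.
rewrite wG ?opprK; last exact: dweight_test.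
by apply: eq_Rintegral => x _; rewrite mulrC.
Qed.

(** [weak_solution] comes with a gradient of its own, [calH1] with the limit [G] of the gradients of
    the approximants; this puts the equation in terms of [G], and of a representative [v] of [u]
    that can be taken positive everywhere. *)
Lemma weak_identity lam p theta (u v : E -> R) (G : E -> E) (psi : E -> R) :
  weak_gradient u G -> weak_solution lam p theta u ->
  measurable_fun B v -> {ae leb, forall x, B x -> u x = v x} ->
  test_function psi ->
  leb.-integrable B (EFin \o (fun x => psi x * rhoV N x * nonlin lam p theta (v x))) /\
  \int[leb]_(x in B) (\sum_(i < N) dweight psi i x * G x ord0 i) =
  \int[leb]_(x in B) (psi x * rhoV N x * nonlin lam p theta (v x)).
Proof.
move=> wG [G' wG' sol] mv uv tp; have mB := @measurable_unit_ball R N.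
have mu_ : measurable_fun B u by case: wG => -[].
have [_ i2 i3 i4] := sol psi tp.
have mpW : measurable_fun B (fun x => psi x * rhoV N x).
  apply: measurable_funM; first exact: (Ck_measurable (test_Ck 0 B tp)).
  exact: (Ck_measurable (@Ck_rhoV R N 0 N)).
have mn (w : E -> R) : measurable_fun B w ->
    measurable_fun B (fun x => psi x * rhoV N x * nonlin lam p theta (w x)).
  move=> mw; apply: measurable_funM => //.
  by apply: (measurableT_comp (measurable_nonlin lam p theta)).
have i2' := integrableZl mB lam i2; have i3' := integrableZl mB theta i3.
have i23 := integrableD mB i2' i3'; have i234 := integrableD mB i23 i4.
have E1 x : psi x * rhoV N x * nonlin lam p theta (u x) =
   lam * (u x * psi x * conformal_factor x ^+ N) +
   theta * (psi x * u x * ln (u x ^+ 2) * conformal_factor x ^+ N) +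
   psi x * (`|u x| `^ (p - 1)) * u x * conformal_factor x ^+ N.
  by rewrite conformal_factor_exp /nonlin; ring.
have iu : leb.-integrable B (EFin \o (fun x => psi x * rhoV N x * nonlin lam p theta (u x))).
  by apply: eq_integrable i234 => // x _ /=; rewrite E1.
have uv' : {ae leb, forall x, B x ->
    psi x * rhoV N x * nonlin lam p theta (u x) = psi x * rhoV N x * nonlin lam p theta (v x)}.
  by apply: filterS uv => x Hx Bx; rewrite Hx.
move=> eqn; split; first exact: (ae_eq_integrable mB (mn _ mv) uv' iu).
rewrite -(ae_eq_Rintegral mB (mn _ mu_) (mn _ mv) uv').
have -> : \int[leb]_(x in B) (psi x * rhoV N x * nonlin lam p theta (u x)) =
  hintegral (fun x => gmetric x (hgrad x (G' x)) (hgrad x (grad psi x))).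
  move/eqP: eqn; rewrite subr_eq => /eqP ->; rewrite /hintegral.
  under eq_Rintegral do rewrite E1.
  rewrite RintegralD// RintegralD// RintegralZl// RintegralZl//; ring.
rewrite (weak_gradient_pairing wG tp).2 -(weak_gradient_pairing wG' tp).2.
apply: eq_Rintegral => x /set_mem Bx.
rewrite gmetric_hgrad// conformal_factor_exp /dotp /dweight mulr_sumr mulr_suml.
by apply: eq_bigr => i _; rewrite mxE; ring.
Qed.

End weak_identity.

Lemma normrM_le_weighted (R : realFieldType) (k a b : R) : 0 < k ->
  `|a * b| <= k * b ^+ 2 + k^-1 * a ^+ 2.
Proof.
move=> k0; have c0 : 0 < k^-1 by rewrite invr_gt0.
have h1 : 0 <= k^-1 * (k * b + a) ^+ 2 by rewrite mulr_ge0 ?sqr_ge0 ?ltW.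
have h2 : 0 <= k^-1 * (k * b - a) ^+ 2 by rewrite mulr_ge0 ?sqr_ge0 ?ltW.
have e1 : k^-1 * (k * b + a) ^+ 2 = k * b ^+ 2 + k^-1 * a ^+ 2 + 2 * (a * b).
  by field; rewrite lt0r_neq0.
have e2 : k^-1 * (k * b - a) ^+ 2 = k * b ^+ 2 + k^-1 * a ^+ 2 - 2 * (a * b).
  by field; rewrite lt0r_neq0.
rewrite e1 in h1; rewrite e2 in h2.
rewrite ler_norml; apply/andP; split; lra.
Qed.

Section test_with_inverse.
Context {R : realType} {N : nat}.
Local Notation E := 'rV[R]_N.
Local Notation leb := (@lebesgue_rV R N).
Local Notation B := (@unit_ball R N).

Lemma csupp_sqr (f : E -> R) : csupp f -> csupp (fun x => f x ^+ 2).
Proof. by move=> sf; under eq_fun do rewrite expr2; exact: csupp_mulr. Qed.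

Lemma test_function_sqr (f : E -> R) : test_function f ->
  test_function (fun x => f x ^+ 2).
Proof.
move=> tf; apply: csupp_smooth; first exact/csupp_sqr/test_csupp.
by move=> k; apply: Ck_exp; [exact: open_unit_ball|exact: test_Ck].
Qed.

Lemma csupp_L2loc (f : E -> R) : csupp f -> Ck 0 B f -> L2loc f.
Proof.
move=> sf cf; split; first exact: Ck_measurable cf.
move=> K cK KB.
have h : leb.-integrable B (EFin \o (fun x => f x ^+ 2)).
  apply: csupp_integrable_ball; first exact: csupp_sqr.
  by apply: Ck_exp => //; exact: open_unit_ball.
have /integrableP[_] := integrableS measurable_unit_ball (compact_measurable_rV cK) KB h.
by under eq_integral do rewrite /= ger0_norm ?sqr_ge0//.
Qed.

Lemma L2loc_sqrB (f g : E -> R) : L2loc f -> L2loc g -> locint (fun x => (f x - g x) ^+ 2).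
Proof.
move=> Lf Lg; have h := locintD (L2loc_sqr Lf) (L2loc_sqr Lg).
apply: (locint_le _ (locintD h h)).
  by apply: measurable_funX; apply: measurable_funB; [case: Lf|case: Lg].
move=> x _; rewrite !ger0_norm ?addr_ge0 ?sqr_ge0//.
have := sqr_ge0 (f x + g x); move: (f x) (g x) => a b; nra.
Qed.

Lemma integrable_mul_bounded (a h : E -> R) C :
  leb.-integrable B (EFin \o a) -> measurable_fun B h -> (forall x, B x -> `|h x| <= C) ->
  leb.-integrable B (EFin \o (fun x => a x * h x)).
Proof.
move=> ia mh bh.
have ch : {ae leb, forall x, B x -> a x != 0 -> (fun=> h x) @ \oo --> h x}.
  by apply: aeW => x _ _; exact: cvg_cst.
exact: (cvg_Rintegral_mul (phi := fun=> h) measurable_unit_ball ia (fun=> mh) mh ch (fun=> bh)).1.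
Qed.

Definition dmass (phi : E -> R) x := rho x ^+ 2 * rhoV N x * phi x ^+ 2.

Lemma dmass_csupp phi : csupp phi -> csupp (dmass phi).
Proof. by move=> sp; apply: csupp_mull; exact: csupp_sqr. Qed.

Lemma dmass_Ck k phi : Ck k B phi -> Ck k B (dmass phi).
Proof.
move=> cp; have oB := @open_unit_ball R N.
apply: Ck_mul => //; last exact: Ck_exp.
by apply: Ck_mul => //; [apply: Ck_exp => //; exact: Ck_rho|exact: Ck_rhoV].
Qed.

Lemma dmass_ge0 phi x : B x -> 0 <= dmass phi x.
Proof. by move=> Bx; rewrite mulr_ge0 ?sqr_ge0// mulr_ge0 ?sqr_ge0 ?rhoV_ge0. Qed.

Lemma test_function_sinv (phi f : E -> R) eta : 0 < eta ->
  test_function phi -> test_function f ->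
  test_function (fun x => phi x ^+ 2 * sinv eta (f x)).
Proof.
move=> e0 tp tf; apply: csupp_smooth; first exact/csupp_mulr/csupp_sqr/test_csupp.
move=> k; have oB := @open_unit_ball R N.
apply: Ck_mul => //; first by apply: Ck_exp => //; exact: test_Ck.
by apply: Ck_sinv => //; exact: test_Ck.
Qed.

Lemma dweight_sinv (phi f : E -> R) eta i x : 0 < eta ->
  test_function phi -> test_function f -> B x ->
  dweight (fun x => phi x ^+ 2 * sinv eta (f x)) i x =
  dweight (fun x => phi x ^+ 2) i x * sinv eta (f x) +
  dmass phi x * dsinv eta (f x) * partial i f x.
Proof.
move=> e0 tp tf Bx; rewrite /dweight /dmass.
have dp2 := CkS_derivable (i := i) (test_Ck 1 B (test_function_sqr tp)) Bx.
have df := CkS_derivable (i := i) (test_Ck 1 B tf) Bx.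
have dsf := CkS_derivable (i := i) (Ck_sinv (@open_unit_ball R N) e0 (test_Ck 1 B tf)) Bx.
rewrite partialM// (_ : partial i (fun y => sinv eta (f y)) x = dsinv eta (f x) * partial i f x).
  by ring.
exact: (partial_comp df (is_derive_sinv (f x) e0)).
Qed.

(** This is the equation tested with [phi ^ 2 * sinv eta u], which need not be smooth; the actual
    test functions are [phi ^ 2 * sinv eta (f n)]. The factors [sinv] and [dsinv] are bounded and
    converge almost everywhere along a subsequence, while the gradients converge in L^2 on the
    support of [phi]. *)
Lemma tested_identity (lam p theta eta : R) (u v phi : E -> R) (G : E -> E) (f : nat -> E -> R) :
  weak_gradient u G -> weak_solution lam p theta u ->
  measurable_fun B v -> {ae leb, forall x, B x -> u x = v x} ->
  (forall n, test_function (f n)) ->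
  (forall K : set E, compact K -> K `<=` unit_ball N ->
    (fun n => \int[leb]_(x in K) ((f n x - u x) ^+ 2)%:E)%E @ \oo --> 0%E /\
    (fun n => \int[leb]_(x in K) (enorm (grad (f n) x - G x) ^+ 2)%:E)%E @ \oo --> 0%E) ->
  test_function phi -> 0 < eta ->
  let a x := \sum_(i < N) dweight (fun x => phi x ^+ 2) i x * G x ord0 i
             - phi x ^+ 2 * rhoV N x * nonlin lam p theta (v x) in
  let D x := \sum_(i < N) dmass phi x * G x ord0 i ^+ 2 in
  [/\ leb.-integrable B (EFin \o (fun x => a x * sinv eta (v x))),
      leb.-integrable B (EFin \o (fun x => D x * dsinv eta (v x))) &
      \int[leb]_(x in B) (a x * sinv eta (v x) + D x * dsinv eta (v x)) = 0].
Proof.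
move=> wG sol mv uv tf lim tp e0 a D.
have mB := @measurable_unit_ball R N.
have oB := @open_unit_ball R N.
have [Lu LG _] := wG.
have tp2 := test_function_sqr tp.
have [K [cK KB phi0]] := test_csupp tp.
have mK := compact_measurable_rV cK.
have [limu limG] := lim K cK KB.
have sd := dmass_csupp (test_csupp tp).
have cd : Ck 0 B (dmass phi) by apply: dmass_Ck; exact: test_Ck.
have [iA _] := weak_gradient_pairing wG tp2.
have [iw _] := weak_identity wG sol mv uv tp2.
have ia : leb.-integrable B (EFin \o a) := integrableB mB iA iw.
have [iD _] : leb.-integrable B (EFin \o D) /\ _ :=
  @Rintegral_sum _ _ _ leb B N (fun i x => dmass phi x * G x ord0 i ^+ 2) mB
  (fun i => integrable_csuppM sd cd (L2loc_sqr (LG i))).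
have mfn n : measurable_fun B (f n) by exact: Ck_measurable (test_Ck 0 B (tf n)).
have ms (h : E -> R) : measurable_fun B h -> measurable_fun B (fun x => sinv eta (h x)).
  by move=> mh; apply: (measurableT_comp (continuous_measurable_fun (continuous_sinv e0))).
have mds (h : E -> R) : measurable_fun B h -> measurable_fun B (fun x => dsinv eta (h x)).
  by move=> mh; apply: (measurableT_comp (continuous_measurable_fun (continuous_dsinv e0))).
have ias n : leb.-integrable B (EFin \o (fun x => a x * sinv eta (f n x))).
  by apply: (integrable_mul_bounded ia (ms _ (mfn n))) => x _; exact: sinv_bound.
have iDs n : leb.-integrable B (EFin \o (fun x => D x * dsinv eta (f n x))).
  by apply: (integrable_mul_bounded iD (mds _ (mfn n))) => x _; exact: dsinv_bound.
pose Rn n x := \sum_(i < N) dmass phi x * (partial i (f n) x - G x ord0 i) ^+ 2.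
have iR n : leb.-integrable B (EFin \o Rn n).
  apply: (@Rintegral_sum _ _ _ leb B N (fun i x => dmass phi x * (partial i (f n) x - G x ord0 i) ^+ 2) mB _).1.
  move=> i; apply: integrable_csuppM => //; apply: L2loc_sqrB => //.
  apply: csupp_L2loc; first exact/csupp_partial/test_csupp.
  by apply: CkS_partial; exact: test_Ck.
pose J n := \int[leb]_(x in B) (a x * sinv eta (f n x)) +
            \int[leb]_(x in B) (D x * dsinv eta (f n x)).
(* The gradient of [f n] is replaced by [G] at the cost of an error controlled by [Rn]. *)
have J_le n (kappa : R) : 0 < kappa -> `|J n| <=
    eta^-1 ^+ 2 * (kappa * \int[leb]_(x in B) D x + kappa^-1 * \int[leb]_(x in B) Rn n x).
  move=> k0.
  have tpsi := test_function_sinv e0 tp (tf n).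
  have [iS eS] := weak_identity wG sol mv uv tpsi.
  have [iG _] := weak_gradient_pairing wG tpsi.
  have iGS := integrableB mB iG iS.
  have iJ := integrableD mB (ias n) (iDs n).
  have -> : J n = \int[leb]_(x in B) (a x * sinv eta (f n x) + D x * dsinv eta (f n x)).
    by rewrite RintegralD.
  have z : \int[leb]_(x in B) (
     (\sum_(i < N) dweight (fun x => phi x ^+ 2 * sinv eta (f n x)) i x * G x ord0 i) -
     phi x ^+ 2 * sinv eta (f n x) * rhoV N x * nonlin lam p theta (v x)) = 0.
    by rewrite RintegralB// eS subrr.
  (* Subtracting the equation tested with [phi ^ 2 * sinv eta (f n)], which is [0], leaves only the
     product of [G] with the gradient error. *)
  rewrite -[X in `|X|]subr0 -z -RintegralB//.
  have iT := integrableB mB iJ iGS.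
  apply: le_trans (le_normr_Rintegral mB iT) _.
  have ikD := integrableZl mB kappa iD; have ikR := integrableZl mB kappa^-1 (iR n).
  have ikDR := integrableD mB ikD ikR.
  rewrite -!RintegralZl//.
  rewrite -RintegralD// -RintegralZl//.
  apply: le_Rintegral => //.
    exact: integrable_norm iT.
    exact: (integrableZl mB _ ikDR).
  move=> x Bx.
  rewrite (_ : _ - _ = - (dsinv eta (f n x) *
    \sum_(i < N) dmass phi x * ((partial i (f n) x - G x ord0 i) * G x ord0 i))); last first.
    set X := \sum_(i < N) dmass phi x * _.
    rewrite (_ : \sum_(i < N) _ = (\sum_(i < N) dweight (fun x => phi x ^+ 2) i x * G x ord0 i) * sinv eta (f n x)
        + dsinv eta (f n x) * (D x + X)); first by rewrite /a; ring.
    rewrite /D /X -big_split/= mulr_sumr mulr_suml -big_split/=.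
    by apply: eq_bigr => i _; rewrite dweight_sinv//; ring.
  rewrite normrN normrM; apply: ler_pM => //; first exact: dsinv_bound.
  apply: le_trans (ler_norm_sum _ _ _) _.
  rewrite /D /Rn !mulr_sumr -big_split/=; apply: ler_sum => i _.
  rewrite normrM (ger0_norm (dmass_ge0 _ Bx)) [kappa * _]mulrCA [kappa^-1 * _]mulrCA -mulrDr.
  by apply: ler_wpM2l; [exact: dmass_ge0|exact: normrM_le_weighted].
have [C C0 HC] := csupp_bounded sd cd.
have mg n : measurable_fun B (fun x => enorm (grad (f n) x - G x) ^+ 2).
  rewrite (_ : (fun x => _) = fun x => \sum_(i < N) (partial i (f n) x - G x ord0 i) ^+ 2); last first.
    apply/funext => x; rewrite enorm_sqr /dotp; apply: eq_bigr => i _.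
    by rewrite !mxE expr2.
  apply: measurable_sum => i; apply: measurable_funX; apply: measurable_funB.
    by apply: (@Ck_measurable _ _ 0); apply: CkS_partial; exact: test_Ck.
  by case: (LG i).
have limR : (fun n => \int[leb]_(x in B) Rn n x) @ \oo --> (0 : R).
  have R_le n : ((\int[leb]_(x in B) Rn n x)%:E <=
      C%:E * \int[leb]_(x in K) (enorm (grad (f n) x - G x) ^+ 2)%:E)%E.
    rewrite fineK; last exact: (integrable_fin_num mB (iR n)).
    rewrite (_ : (\int[leb]_(x in B) (Rn n x)%:E =
        \int[leb]_(x in K) (dmass phi x * enorm (grad (f n) x - G x) ^+ 2)%:E)%E).
      rewrite -ge0_integralZl_EFin//; first last.
      - exact: ltW.
      - by apply/measurable_EFinP; exact: measurable_funS (mg n).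
      - by move=> x _; rewrite lee_fin sqr_ge0.
      have mdm : measurable_fun B (dmass phi) by exact: Ck_measurable cd.
      apply: ge0_le_integral => //.
      - by move=> x /KB Bx; rewrite lee_fin mulr_ge0 ?sqr_ge0 ?dmass_ge0.
      - apply/measurable_EFinP; apply: (measurable_funS mB KB).
        exact: measurable_funM.
      - apply/measurable_EFinP; apply: (measurable_funS mB KB).
        exact: measurable_funM.
      - move=> x _; rewrite -EFinM lee_fin ler_wpM2r ?sqr_ge0//.
        by apply: le_trans (HC x); exact: ler_norm.
    rewrite -[X in _ = integral _ X _](setIidr KB) integral_mkcondr.
    apply: eq_integral => x _.
    rewrite patchE /Rn -mulr_sumr enorm_sqr /dotp.
    under [in RHS]eq_bigr do rewrite !mxE -expr2.
    case: ifPn => // /negP; rewrite inE => Kx.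
    by rewrite /dmass phi0// expr0n/= mulr0 mul0r.
  have c1 : (fun n => C%:E * \int[leb]_(x in K) (enorm (grad (f n) x - G x) ^+ 2)%:E)%E @ \oo --> 0%E.
    by rewrite -[X in _ --> X](mule0 C%:E); apply: cvgeZl.
  have : (fun n => (\int[leb]_(x in B) Rn n x)%:E) @ \oo --> 0%E.
    apply: (squeeze_cvge _ (cvg_cst 0%E) c1); apply: nearW => n.
    rewrite R_le andbT lee_fin; apply: Rintegral_ge0 => x Bx.
    by apply: sumr_ge0 => i _; rewrite mulr_ge0 ?sqr_ge0 ?dmass_ge0.
  by move=> /fine_cvgP[].
have [s sk aes] := @L2_ae_subsequence _ _ _ leb K (fun n x => f n x - u x) mK
  (fun n => measurable_funS mB KB (measurable_funB (mfn n) (let: And3 (conj h _) _ _ := wG in h))) limu.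
have soo : s @ \oo --> \oo.
  apply/cvgnyPge => M; near=> n; apply: leq_trans (sk n); near: n; exact: nbhs_infty_ge.
(* Almost everywhere convergence is known on [K] only; [a] and [D] vanish off [K]. *)
have out_a x : a x != 0 -> K x.
  move=> a0; apply: contrapT => Kx; move/eqP: a0; apply.
  have oK : open (~` K) by apply: closed_openC; exact: compact_closed_rV.
  rewrite /a phi0// expr0n/= !mul0r subr0 big1// => i _.
  rewrite /dweight (@partial_zero _ _ (~` K)) ?mulr0 ?mul0r//.
  by move=> y Ky; rewrite phi0// expr0n.
have out_D x : D x != 0 -> K x.
  move=> a0; apply: contrapT => Kx; move/eqP: a0; apply.
  by rewrite /D big1// => i _; rewrite /dmass phi0// expr0n/= mulr0 mul0r.
have aev : {ae leb, forall x, B x -> K x -> (fun k => f (s k) x) @ \oo --> v x}.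
  apply: filterS2 uv aes => x uvx Hx Bx Kx; rewrite -uvx//.
  by apply/subr_cvg0; exact: Hx.
have aea : {ae leb, forall x, B x -> a x != 0 ->
    (fun k => sinv eta (f (s k) x)) @ \oo --> sinv eta (v x)}.
  apply: filterS aev => x Hx Bx ax.
  by apply: continuous_cvg; [exact: continuous_sinv|exact: (Hx Bx (out_a x ax))].
have aeD : {ae leb, forall x, B x -> D x != 0 ->
    (fun k => dsinv eta (f (s k) x)) @ \oo --> dsinv eta (v x)}.
  apply: filterS aev => x Hx Bx ax.
  by apply: continuous_cvg; [exact: continuous_dsinv|exact: (Hx Bx (out_D x ax))].
have [ia1 c1] := cvg_Rintegral_mul (phi := fun k x => sinv eta (f (s k) x)) mB ia
  (fun k => ms _ (mfn (s k))) (ms _ mv) aea (fun k x _ => sinv_bound (f (s k) x) e0).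
have [iD1 c2] := cvg_Rintegral_mul (phi := fun k x => dsinv eta (f (s k) x)) mB iD
  (fun k => mds _ (mfn (s k))) (mds _ mv) aeD (fun k x _ => dsinv_bound (f (s k) x) e0).
split=> //.
rewrite RintegralD//; apply/eqP; rewrite -normr_le0; apply/ler_addgt0Pl => e e_0.
rewrite addr0.
(* At fixed [kappa] the limit in [n] removes the [kappa^-1] term and leaves [kappa * I], at most [e]
   for this [kappa]; the [1] in the denominator covers [I = 0]. *)
pose I := eta^-1 ^+ 2 * \int[leb]_(x in B) D x.
have I0 : 0 <= I.
  rewrite mulr_ge0 ?exprn_ge0 ?invr_ge0 ?(ltW e0)//; apply: Rintegral_ge0 => x Bx.
  by apply: sumr_ge0 => i _; rewrite mulr_ge0 ?sqr_ge0 ?dmass_ge0.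
pose kappa := e / (I + 1).
have kappa0 : 0 < kappa by rewrite divr_gt0// ltr_wpDl.
apply: (@le_trans _ _ (kappa * I)); last first.
  rewrite /kappa mulrAC ler_pdivrMr ?ltr_wpDl// ler_wpM2l// ?lerDl// ltW//.
have cJ : (fun k => `|J (s k)|) @ \oo --> `|\int[leb]_(x in B) (a x * sinv eta (v x)) +
    \int[leb]_(x in B) (D x * dsinv eta (v x))|.
  by apply: cvg_norm; exact: cvgD c1 c2.
have cR : (fun k => eta^-1 ^+ 2 * (kappa * \int[leb]_(x in B) D x +
    kappa^-1 * \int[leb]_(x in B) Rn (s k) x)) @ \oo --> kappa * I.
  rewrite (_ : kappa * I = eta^-1 ^+ 2 * (kappa * \int[leb]_(x in B) D x + kappa^-1 * 0)); last first.
    by rewrite /I; ring.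
  apply: cvgMr; apply: cvgD; first exact: cvg_cst.
  by apply: cvgMr; exact: (cvg_comp _ _ soo limR).
apply: (ler_cvg_to cJ cR); apply: nearW => k; exact: J_le.
Unshelve. all: by end_near. Qed.

End test_with_inverse.

(** * The integral inequality for an arbitrary cutoff *)

Section supersolution.
Context {R : realType} {N : nat}.
Local Notation E := 'rV[R]_N.
Local Notation leb := (@lebesgue_rV R N).
Local Notation B := (@unit_ball R N).

Lemma energy_csupp (phi : E -> R) : csupp phi ->
  csupp (fun x => rho x ^+ 2 * rhoV N x * dotp (grad phi x) (grad phi x)).
Proof. by move=> sp; apply: csupp_mull; exact: csupp_grad2. Qed.

Lemma energy_Ck k (phi : E -> R) : Ck k.+1 B phi ->
  Ck k B (fun x => rho x ^+ 2 * rhoV N x * dotp (grad phi x) (grad phi x)).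
Proof.
move=> cp; have oB := @open_unit_ball R N.
apply: Ck_mul => //; last exact: Ck_grad2.
by apply: Ck_mul => //; [apply: Ck_exp => //; exact: Ck_rho|exact: Ck_rhoV].
Qed.

(* Young's inequality absorbs the gradient of [v] into the term coming from
   [dsinv <= - 3/4 sinv ^ 2]. *)
Lemma tested_pointwise (lam p theta L eta : R) (v phi : E -> R) (G : E -> E) x :
  theta < 0 -> 0 < eta -> test_function phi -> B x -> 0 < v x ->
  (\sum_(i < N) dweight (fun x => phi x ^+ 2) i x * G x ord0 i
   - phi x ^+ 2 * rhoV N x * nonlin lam p theta (v x)) * sinv eta (v x)
  + (\sum_(i < N) dmass phi x * G x ord0 i ^+ 2) * dsinv eta (v x) <=
  4 / 3 * (rho x ^+ 2 * rhoV N x * dotp (grad phi x) (grad phi x))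
  - (lam - 2 * theta * (L + 1)) * (phi x ^+ 2 * rhoV N x * (v x * sinv eta (v x)))
  + (phi x ^+ 2 * rhoV N x + (- 2 * theta * expR L) ^+ 2 / 4 * (phi x ^+ 2 * rhoV N x * v x ^+ 2)).
Proof.
move=> th0 e0 tp Bx v0.
have W0 := rhoV_ge0 N Bx.
have k0 : 0 <= phi x ^+ 2 * rhoV N x by rewrite mulr_ge0 ?sqr_ge0.
have s0 := sinv_ge0 e0 (ltW v0); have vs1 := mul_sinv_le1 e0 (ltW v0).
have vs0 : 0 <= v x * sinv eta (v x) by rewrite mulr_ge0// ltW.
have ds := dsinv_le e0 (ltW v0).
have nl := nonlin_ge lam p L th0 v0.
have gradpart : (\sum_(i < N) dweight (fun x => phi x ^+ 2) i x * G x ord0 i) * sinv eta (v x) +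
    (\sum_(i < N) dmass phi x * G x ord0 i ^+ 2) * dsinv eta (v x) <=
    4 / 3 * (rho x ^+ 2 * rhoV N x * dotp (grad phi x) (grad phi x)).
  rewrite /dotp !mulr_suml !mulr_sumr -big_split/=; apply: ler_sum => i _.
  have dphi := CkS_derivable (i := i) (test_Ck 1 B tp) Bx.
  rewrite /dweight partialX2// /dmass !mxE.
  have r0 : 0 <= rho x ^+ 2 * rhoV N x by rewrite mulr_ge0 ?sqr_ge0.
  move: r0 ds; set r := rho x ^+ 2 * rhoV N x; set s := sinv eta (v x); set d := dsinv _ _.
  move: (phi x) (G x ord0 i) (partial i phi x) => a g b r0 ds.
  have h1 : r * (a * g) ^+ 2 * d <= r * (a * g) ^+ 2 * - (3 / 4 * s ^+ 2).
    by rewrite ler_wpM2l// mulr_ge0// sqr_ge0.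
  (* Origin of [4 / 3]: with [X = a * g * s], this square states
     [2 * b * X - 3/4 * X ^ 2 <= 4/3 * b ^ 2]. *)
  have h2 : 0 <= r * (2 * b - 3 / 2 * (a * g * s)) ^+ 2 / 3.
    by rewrite divr_ge0// mulr_ge0 ?sqr_ge0.
  rewrite -subr_ge0.
  rewrite (_ : _ - _ = r * (2 * b - 3 / 2 * (a * g * s)) ^+ 2 / 3 +
     (r * (a * g) ^+ 2 * - (3 / 4 * s ^+ 2) - r * (a * g) ^+ 2 * d)); last by field.
  by rewrite addr_ge0// subr_ge0.
have masspart : - (phi x ^+ 2 * rhoV N x * nonlin lam p theta (v x) * sinv eta (v x)) <=
    - (lam - 2 * theta * (L + 1)) * (phi x ^+ 2 * rhoV N x * (v x * sinv eta (v x)))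
    + (phi x ^+ 2 * rhoV N x + (- 2 * theta * expR L) ^+ 2 / 4 * (phi x ^+ 2 * rhoV N x * v x ^+ 2)).
  have C0 : 0 <= - 2 * theta * expR L.
    by rewrite mulr_ge0 ?expR_ge0// mulNr -mulrN mulr_ge0// oppr_ge0 ltW.
  move: k0 nl C0 vs0 vs1 s0; set k := phi x ^+ 2 * rhoV N x; set M := lam - _; set C := - 2 * theta * _.
  move: (nonlin lam p theta (v x)) (sinv eta (v x)) => n s.
  move: (v x) v0 => t t0 k0 nl C0 vs0 vs1 s0.
  have h1 : k * s * (M * t - C * t ^+ 2) <= k * s * n by rewrite ler_wpM2l// mulr_ge0.
  have h2 : k * (C * t) * (t * s) <= k * (C * t).
    by rewrite ler_piMr// mulr_ge0// mulr_ge0// ltW.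
  (* That is [C * t <= 1 + C ^ 2 * t ^ 2 / 4]; its constant [1] becomes the [- 1] in the coefficient
     of [supersolution_inequality]. *)
  have h3 : 0 <= k * (1 - C * t / 2) ^+ 2 by rewrite mulr_ge0 ?sqr_ge0.
  rewrite -subr_ge0.
  rewrite (_ : _ - _ = (k * s * n - k * s * (M * t - C * t ^+ 2)) +
    (k * (C * t) - k * (C * t) * (t * s)) + k * (1 - C * t / 2) ^+ 2); last by field.
  by apply: addr_ge0 h3; apply: addr_ge0; rewrite subr_ge0.
apply: le_trans (_ : _ <= 4 / 3 * (rho x ^+ 2 * rhoV N x * dotp (grad phi x) (grad phi x)) +
  - (phi x ^+ 2 * rhoV N x * nonlin lam p theta (v x) * sinv eta (v x))) _.
  by rewrite mulrBl addrAC lerD2r.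
by apply: le_trans (lerD (lexx _) masspart) _; rewrite !mulNr !addrA.
Qed.

(** [tested_pointwise] integrated, with [eta = 1 / (k + 1)] tending to [0]. Only the mass term on
    the left depends on [eta]; there [v * sinv eta v] stays in [[0, 1]] and tends to [1] because [v]
    is positive. *)
Theorem supersolution_inequality (lam p theta L : R) (u v phi : E -> R) (G : E -> E)
    (f : nat -> E -> R) : theta < 0 ->
  weak_gradient u G -> weak_solution lam p theta u ->
  measurable_fun B v -> {ae leb, forall x, B x -> u x = v x} ->
  (forall x, 0 < v x) -> locint (fun x => v x ^+ 2) ->
  (forall n, test_function (f n)) ->
  (forall K : set E, compact K -> K `<=` unit_ball N ->
    (fun n => \int[leb]_(x in K) ((f n x - u x) ^+ 2)%:E)%E @ \oo --> 0%E /\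
    (fun n => \int[leb]_(x in K) (enorm (grad (f n) x - G x) ^+ 2)%:E)%E @ \oo --> 0%E) ->
  test_function phi ->
  (lam - 2 * theta * (L + 1) - 1) * \int[leb]_(x in B) (phi x ^+ 2 * rhoV N x) <=
  4 / 3 * \int[leb]_(x in B) (rho x ^+ 2 * rhoV N x * dotp (grad phi x) (grad phi x)) +
  (- 2 * theta * expR L) ^+ 2 / 4 *
    \int[leb]_(x in B) (phi x ^+ 2 * rhoV N x * v x ^+ 2).
Proof.
move=> th0 wG sol mv uv v0 Iv tf lim tp.
have mB := @measurable_unit_ball R N; have oB := @open_unit_ball R N.
have sk : csupp (fun x => phi x ^+ 2 * rhoV N x) by exact/csupp_mulr/csupp_sqr/test_csupp.
have ck : Ck 0 B (fun x => phi x ^+ 2 * rhoV N x).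
  by apply: Ck_mul => //; [apply: Ck_exp => //; exact: test_Ck|exact: Ck_rhoV].
have ik := csupp_integrable_ball sk ck.
have iv := integrable_csuppM sk ck Iv.
have iP := csupp_integrable_ball (energy_csupp (test_csupp tp)) (energy_Ck (test_Ck 1 B tp)).
set M := lam - 2 * theta * (L + 1); set C := (- 2 * theta * expR L) ^+ 2 / 4.
have ms eta : 0 < eta -> measurable_fun B (fun x => v x * sinv eta (v x)).
  move=> e0; apply: measurable_funM => //.
  by apply: (measurableT_comp (continuous_measurable_fun (continuous_sinv e0))).
have bs eta x : 0 < eta -> `|v x * sinv eta (v x)| <= 1.
  move=> e0; have v0' := ltW (v0 x).
  by rewrite ger0_norm ?mul_sinv_le1// mulr_ge0// sinv_ge0.
have ineq eta : 0 < eta ->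
    M * \int[leb]_(x in B) (phi x ^+ 2 * rhoV N x * (v x * sinv eta (v x))) <=
    4 / 3 * \int[leb]_(x in B) (rho x ^+ 2 * rhoV N x * dotp (grad phi x) (grad phi x)) +
    (\int[leb]_(x in B) (phi x ^+ 2 * rhoV N x) +
     C * \int[leb]_(x in B) (phi x ^+ 2 * rhoV N x * v x ^+ 2)).
  move=> e0.
  have is_ := integrable_mul_bounded ik (ms _ e0) (fun x _ => bs eta x e0).
  have [i1 i2 eq0] := tested_identity wG sol mv uv tf lim tp e0.
  have j1 := integrableZl mB (4 / 3) iP; have j2 := integrableZl mB M is_.
  have j3 := integrableZl mB C iv.
  have j12 := integrableB mB j1 j2; have j34 := integrableD mB ik j3.
  have := le_Rintegral mB (integrableD mB i1 i2) (integrableD mB j12 j34)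
    (fun x Bx => tested_pointwise lam p L G th0 e0 tp Bx (v0 x)).
  rewrite /= eq0 RintegralD// RintegralB// RintegralD// !RintegralZl//.
  by rewrite addrAC subr_ge0.
have k0 k : 0 < (k.+1%:R^-1 : R) by rewrite invr_gt0.
have ae1 : {ae leb, forall x, B x -> phi x ^+ 2 * rhoV N x != 0 ->
    (fun k => v x * sinv (k.+1%:R^-1) (v x)) @ \oo --> (1 : R)}.
  by apply: aeW => x _ _; exact: cvg_mul_sinv.
have [_ lim1] := cvg_Rintegral_mul (phi := fun k x => v x * sinv (k.+1%:R^-1) (v x))
  (psi := cst 1) mB ik (fun k => ms _ (k0 k)) (measurable_cst _)
  ae1 (fun k x _ => bs _ x (k0 k)).
rewrite mulrBl mul1r lerBlDr -addrA [C * _ + _]addrC.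
have limM : (fun k => M * \int[leb]_(x in B) (phi x ^+ 2 * rhoV N x * (v x * sinv (k.+1%:R^-1) (v x))))
    @ \oo --> M * \int[leb]_(x in B) (phi x ^+ 2 * rhoV N x).
  apply: cvgMr; rewrite (_ : \int[leb]_(x in B) (phi x ^+ 2 * rhoV N x) =
    \int[leb]_(x in B) (phi x ^+ 2 * rhoV N x * cst 1 x))//.
  by apply: eq_Rintegral => x _; rewrite /= mulr1.
by apply: (ler_cvg_to limM (cvg_cst _)); apply: nearW => k; exact: ineq.
Qed.

End supersolution.

(** * Radial cutoffs near the boundary *)

Section radial_cutoff.
Context {R : realType} (m : nat).
Local Notation N := m.+1.
Local Notation E := 'rV[R]_N.
Local Notation leb := (@lebesgue_rV R N).
Local Notation B := (@unit_ball R N).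
Implicit Types (eps : R) (p : {poly R}).

(* A profile of [1 - (eps / rho) ^ m]. The explicit test is needed because
   [rhoV m] is a junk value outside of the ball. *)
Definition cutoff eps p (x : E) : R :=
  if 0 < rho x then flat p (1 - eps ^+ m * rhoV m x) else 0.

Lemma cutoffE eps p x : B x -> cutoff eps p x = flat p (1 - eps ^+ m * rhoV m x).
Proof. by move=> /unit_ballP x0; rewrite /cutoff x0. Qed.

Lemma cutoff_core eps p x : 0 < eps -> cutoff eps p x != 0 -> core eps x /\ eps ^+ m * rhoV m x <= 1.
Proof.
move=> e0; rewrite /cutoff; case: ifPn => [x0|]; last by rewrite eqxx.
rewrite /flat; case: ifPn => [z0 _|]; last by rewrite eqxx.
have h : eps ^+ m * rhoV m x < 1 by rewrite -subr_gt0.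
split; last exact: ltW.
rewrite /core/= leNgt; apply/negP => xe; move: h; rewrite ltNge => /negP; apply.
by rewrite /rhoV -exprMn exprn_ege1// ler_pdivlMr ?mul1r ?ltW.
Qed.

Lemma cutoff_csupp eps p : 0 < eps -> csupp (cutoff eps p).
Proof.
move=> e0; exists (core eps); split; [exact: compact_core|exact: core_sub_ball|].
by move=> x cx; apply/eqP; apply: contra_notT cx => /(cutoff_core e0)[].
Qed.

Let Ck_arg k eps : Ck k B (fun x => 1 + - eps ^+ m * rhoV m x).
Proof.
have oB := @open_unit_ball R N.
by apply: Ck_add => //; [exact: Ck_cst|apply: Ck_mul => //; [exact: Ck_cst|exact: Ck_rhoV]].
Qed.

Lemma cutoff_Ck k eps p : Ck k B (cutoff eps p).
Proof.
have oB := @open_unit_ball R N.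
apply: Ck_eq (Ck_flat p oB (Ck_arg k eps)) => // x Bx.
by rewrite /= cutoffE// mulNr.
Qed.

Lemma cutoff_test eps p : 0 < eps -> test_function (cutoff eps p).
Proof. by move=> e0; apply: csupp_smooth; [exact: cutoff_csupp|move=> k; exact: cutoff_Ck]. Qed.

(** The derivative of a cutoff is again a cutoff up to an explicit factor; the polynomial parameter
    exists for this. *)
Lemma partial_cutoff eps p i x : B x -> partial i (cutoff eps p) x =
  - (m%:R * eps ^+ m * rhoV N x * x ord0 i) * cutoff eps ('X^2 * (p - p^`())) x.
Proof.
move=> Bx; have oB := @open_unit_ball R N.
have dz := CkS_derivable (i := i) (Ck_arg 1 eps) Bx.
have dW := CkS_derivable (i := i) (@Ck_rhoV R N 1 m) Bx.
transitivity (partial i (flat p \o (fun x => 1 + - eps ^+ m * rhoV m x)) x).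
  apply: near_eq_derive; apply: (open_near_eq oB Bx) => y By.
  by rewrite /= cutoffE// mulNr.
rewrite (partial_comp dz (is_derive_flat _ _)) cutoffE// mulNr mulrC; congr (_ * _).
have -> : partial i (fun x => 1 + - eps ^+ m * rhoV m x) x = - eps ^+ m * partial i (rhoV m) x.
  rewrite /partial (deriveD (derivable_cst _ _ _)).
    by rewrite derive_cst add0r (deriveM (derivable_cst _ _ _) dW) derive_cst scaler0 addr0.
  exact: derivableM (derivable_cst _ _ _) dW.
by rewrite partial_rhoV//; ring.
Qed.


Lemma Ck_dotp k (D : set E) : open D -> Ck k D (fun x : E => dotp x x).
Proof. by move=> oD; apply: Ck_sum => // i; apply: Ck_mul => //; exact: Ck_coord. Qed.

(** Divergence theorem for the field [c x *: x]. Since the gradient of [rho] is [- x], the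
    hypothesis says, for [c] a function of [rho], that [kappa * rhoV N * d] is its derivative in
    [rho]. Integrals against the hyperbolic volume thus become plain Lebesgue integrals, which are
    easy to bound uniformly in [eps]. *)
Lemma radial_ibp (kappa : R) (c d : E -> R) : test_function c ->
  csupp d -> Ck 0 B d ->
  (forall i x, B x -> partial i c x = - (kappa * rhoV N x * x ord0 i) * d x) ->
  kappa * \int[leb]_(x in B) (rhoV N x * dotp x x * d x) = N%:R * \int[leb]_(x in B) c x.
Proof.
move=> tc sd cd dc; have oB := @open_unit_ball R N; have mB := @measurable_unit_ball R N.
pose g (i : 'I_N) (x : E) := c x * x ord0 i.
have [] := @Rintegral_sum_partial R m N g id.
- by move=> i; apply/csupp_mulr/test_csupp.
- by move=> i; apply: Ck_mul => //; [exact: test_Ck|exact: Ck_coord].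
have E1 x : B x -> \sum_(i < N) partial i (g i) x =
    N%:R * c x - kappa * (rhoV N x * dotp x x * d x).
  move=> Bx; have dcx i := CkS_derivable (i := i) (test_Ck 1 B tc) Bx.
  have dx i := CkS_derivable (i := i) (@Ck_coord R N 1 B i) Bx.
  have Pi i : partial i (g i) x = c x + - (kappa * rhoV N x * d x) * (x ord0 i * x ord0 i).
    by rewrite partialM// partial_coordE dc//; ring.
  under eq_bigr do rewrite Pi.
  by rewrite big_split/= -mulr_sumr sumr_const card_ord -[_ *+ N]mulr_natl -/(dotp x x); ring.
move=> _; under eq_Rintegral => x /set_mem Bx do rewrite E1//.
have ic : leb.-integrable B (EFin \o c).
  by apply: csupp_integrable_ball; [exact: test_csupp|exact: test_Ck].
have id_ : leb.-integrable B (EFin \o (fun x => rhoV N x * dotp x x * d x)).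
  apply: csupp_integrable_ball; first exact: csupp_mull.
  by apply: Ck_mul => //; apply: Ck_mul => //; [exact: Ck_rhoV|exact: Ck_dotp].
rewrite RintegralB//; [|exact: (integrableZl mB N%:R ic)|exact: (integrableZl mB kappa id_)].
by rewrite !RintegralZl// => /eqP; rewrite subr_eq0 => /eqP.
Qed.

Lemma flat1_le1 t : flat (1 : {poly R}) t <= 1.
Proof.
rewrite /flat; case: ifP => // t0; rewrite hornerC mul1r -expR0 ler_expR oppr_le0.
by rewrite invr_ge0 ltW.
Qed.

Lemma flat1_ge0 t : 0 <= flat (1 : {poly R}) t.
Proof. by rewrite /flat; case: ifP => // t0; rewrite hornerC mul1r expR_ge0. Qed.

Lemma flat_X2_ge0 t : 0 <= flat ('X^2 : {poly R}) t.
Proof.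
by rewrite /flat; case: ifP => // t0; rewrite hornerXn mulr_ge0 ?expR_ge0// sqr_ge0.
Qed.

Lemma flat_bounded p : exists2 C : R, 0 < C & forall t, `|flat p t| <= C.
Proof.
have [C HC] := expR_poly_bounded p; exists (`|C| + 1); first by rewrite ltr_wpDl.
move=> t; rewrite /flat; case: ifPn => t0; last by rewrite normr0 addr_ge0.
have := HC t^-1; rewrite invr_gt0 t0 => /(_ isT) /le_trans; apply.
by rewrite ler_wpDr// ler_norm.
Qed.

(** The reason for the choice [phi = cutoff eps 'X]: the derivative of [flat 1] is [flat 'X^2], so
    that of [flat 1 ^ 2] is [2 * flat 'X ^ 2], and [phi ^ 2] is itself a derivative to which
    [radial_ibp] applies. *)
Lemma cutoff_1_X2 eps x : B x -> cutoff eps 1 x * cutoff eps 'X^2 x = cutoff eps 'X x ^+ 2.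
Proof.
move=> Bx; rewrite !cutoffE// /flat; case: ifP => _; last by rewrite mulr0 expr0n.
by rewrite hornerC hornerXn hornerX; ring.
Qed.

Lemma integrable_bounded_ball (h : E -> R) (C : R) : measurable_fun B h ->
  (forall x, B x -> `|h x| <= C) -> leb.-integrable B (EFin \o h).
Proof.
move=> mh bh; apply: measurable_bounded_integrable => //.
- exact: measurable_unit_ball.
- exact: lebesgue_ball_lty.
- by exists C; split; [rewrite num_real|move=> M CM x Bx; apply: le_trans (bh x Bx) (ltW CM)].
Qed.

(** The Lebesgue measure of the ball [|x| ^ 2 <= 1 / 2], a fixed set on which the cutoffs are
    bounded below once [eps <= 1 / 8]. *)
Definition quarter_mass : R := \int[leb]_(x in B) \1_(core (4^-1) : set E) x.

Lemma quarter_mass_gt0 : 0 < quarter_mass.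
Proof.
have c0 : 0 < (4^-1 : R) by rewrite invr_gt0.
have mK : measurable (core (4^-1 : R) : set E).
  by apply: compact_measurable_rV; exact: compact_core.
rewrite /quarter_mass /Rintegral integral_indic//; last exact: measurable_unit_ball.
rewrite setIidl; last exact: core_sub_ball.
(* On the cube of half-side [r], [|x| ^ 2 <= N * r ^ 2 = r / 2 <= 1 / 4]. *)
pose r : R := (2 * N%:R)^-1.
have N0 : 0 < (N%:R : R) by rewrite ltr0n.
have r0 : 0 < r by rewrite invr_gt0 mulr_gt0.
have sub : @box R N r `<=` core 4^-1.
  move=> x bx; rewrite /core/= /rho.
  have : dotp x x <= N%:R * r ^+ 2.
    rewrite -[N in N%:R]card_ord mulr_natl -sumr_const; apply: ler_sum => i _.
    by rewrite -expr2 -real_normK ?num_real// lerXn2r ?nnegrE// ltW.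
  have Nr : N%:R * r = 2^-1 by rewrite /r; field; rewrite lt0r_neq0.
  rewrite expr2 mulrA Nr => dx.
  have : r <= 2^-1 by rewrite lef_pV2 ?posrE ?mulr_gt0// ler_peMr// ler1n.
  by lra.
have box_lt : (leb (@box R N r) <= leb (core 4^-1))%E.
  by apply: le_measure; rewrite ?inE//; exact: measurable_box.
have core_lt : (leb (core 4^-1) < +oo)%E.
  apply: le_lt_trans (@lebesgue_ball_lty R N); apply: le_measure; rewrite ?inE//.
    exact: measurable_unit_ball.
  exact: core_sub_ball.
have box_gt : (0 < leb (@box R N r))%E.
  by rewrite lebesgue_box ?(ltW r0)// lte_fin exprn_gt0// mulr_gt0.
rewrite -lte_fin fineK; first exact: lt_le_trans box_gt box_lt.
by rewrite ge0_fin_numE// measure_ge0.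
Qed.

(* Since [|x| <= 1], the radial integration by parts for [cutoff eps 1 ^ 2] bounds the
   mass of [cutoff eps 'X] from below. *)
Lemma cutoff_mass_ge eps : (0 < m)%N -> 0 < eps -> eps <= 8^-1 ->
  N%:R / (2 * m%:R) * (expR (- 2) ^+ 2 * quarter_mass) <=
  eps ^+ m * \int[leb]_(x in B) (cutoff eps 'X x ^+ 2 * rhoV N x).
Proof.
move=> m0 e0 e8; have oB := @open_unit_ball R N; have mB := @measurable_unit_ball R N.
have mR : 0 < (m%:R : R) by rewrite ltr0n.
have t1 := cutoff_test 1 e0; have tX := cutoff_test 'X e0.
have ib := @radial_ibp (2 * m%:R * eps ^+ m) (fun x => cutoff eps 1 x ^+ 2)
  (fun x => cutoff eps 'X x ^+ 2) (test_function_sqr t1) (csupp_sqr (test_csupp tX))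
  (Ck_exp 2 oB (test_Ck 0 B tX)).
have {}ib := ib _; rewrite -(@ler_pM2l _ (2 * m%:R)) ?mulr_gt0//.
rewrite [leLHS](_ : _ = N%:R * (expR (- 2) ^+ 2 * quarter_mass)); last first.
  by field; rewrite lt0r_neq0.
have i1 : leb.-integrable B (EFin \o (fun x => rhoV N x * dotp x x * cutoff eps 'X x ^+ 2)).
  apply: csupp_integrable_ball; first by apply: csupp_mull; exact/csupp_sqr/test_csupp.
  apply: Ck_mul => //; first by apply: Ck_mul => //; [exact: Ck_rhoV|exact: Ck_dotp].
  by apply: Ck_exp => //; exact: test_Ck.
have i2 : leb.-integrable B (EFin \o (fun x => cutoff eps 'X x ^+ 2 * rhoV N x)).
  apply: csupp_integrable_ball; first by apply: csupp_mulr; exact/csupp_sqr/test_csupp.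
  by apply: Ck_mul => //; [apply: Ck_exp => //; exact: test_Ck|exact: Ck_rhoV].
have i3 : leb.-integrable B (EFin \o (fun x => cutoff eps 1 x ^+ 2)).
  apply: csupp_integrable_ball; first exact/csupp_sqr/test_csupp.
  by apply: Ck_exp => //; exact: test_Ck.
have i4 : leb.-integrable B (EFin \o (\1_(core (4^-1)) : E -> R)).
  apply: (@integrable_bounded_ball _ 1).
    by apply: measurable_indic; apply: compact_measurable_rV; apply: compact_core.
  by move=> x _; rewrite indicE; case: (_ \in _); rewrite ?normr1 ?normr0.
apply: (@le_trans _ _ (N%:R * \int[leb]_(x in B) (cutoff eps 1 x ^+ 2))).
  rewrite ler_wpM2l// /quarter_mass -RintegralZl//.
  apply: le_Rintegral => //; first exact: (integrableZl mB _ i4).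
  move=> x Bx; rewrite indicE; case: (boolP (x \in _)) => [|_]; last first.
    by rewrite mulr0 sqr_ge0.
  rewrite inE /core/= mulr1 => x4.
  have x0 : 0 < rho x by apply: lt_le_trans x4; rewrite invr_gt0.
  rewrite lerXn2r ?nnegrE ?expR_ge0//.
    by rewrite cutoffE//; exact: flat1_ge0.
  (* From [rho >= 1 / 4] and [eps <= 1 / 8], [(eps / rho) ^ m <= eps / rho <= 1 / 2]; at an argument
     at least [1 / 2], [flat 1] is at least [exp (- 2)]. *)
  have z : 2^-1 <= 1 - eps ^+ m * rhoV m x.
    have q : eps / rho x <= 2^-1.
      rewrite ler_pdivrMr//; move: x4 e8; move: (rho x) => q; lra.
    rewrite lerBrDl -lerBrDr (_ : 1 - 2^-1 = 2^-1); last by field.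
    rewrite /rhoV -exprMn; apply: (le_trans _ q).
    rewrite -[leRHS]expr1; apply: ler_wiXn2l => //.
      by rewrite divr_ge0// ltW.
    by apply: le_trans q _; rewrite invf_le1 ?ler1n.
  rewrite cutoffE// /flat ifT; last by apply: lt_le_trans z; rewrite invr_gt0.
  rewrite hornerC mul1r ler_expR lerN2 invf_ple ?posrE//.
  by apply: lt_le_trans z; rewrite invr_gt0.
rewrite -ib => [|i x Bx]; last first.
  rewrite partialX2; last exact: CkS_derivable (test_Ck 1 B t1) Bx.
  rewrite partial_cutoff// derivC subr0 mulr1 -(cutoff_1_X2 _ Bx); ring.
rewrite [leRHS]mulrA ler_pM2l; last by rewrite !mulr_gt0// exprn_gt0.
apply: le_Rintegral => // x Bx.
rewrite [leLHS](_ : _ = dotp x x * (cutoff eps 'X x ^+ 2 * rhoV N x)); last by ring.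
rewrite ler_piMl//.
  by rewrite mulr_ge0 ?sqr_ge0 ?rhoV_ge0.
by have := (unit_ballP x).1 Bx; rewrite dotp_rho; move: (rho x) => q; lra.
Qed.

(** One factor of the squared gradient combines with [rho ^ 2] into [(eps ^ m * rhoV m) ^ 2], at
    most [1] on the support. What remains is [rhoV N * |x| ^ 2] times the square of a cutoff,
    bounded by [C * cutoff eps 'X^2]; [radial_ibp] turns this into the integral of [cutoff eps 1], a
    function at most [1]. *)
Lemma cutoff_energy_le : exists C : R, forall eps, 0 < eps ->
  eps ^+ m * \int[leb]_(x in B)
    (rho x ^+ 2 * rhoV N x * dotp (grad (cutoff eps 'X) x) (grad (cutoff eps 'X) x)) <= C.
Proof.
(* The profile of the gradient is [X^2 * (X - 1)]; its square carries two exponentials, one spent on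
   this bound and one kept to form [flat 'X^2]. *)
have [C HC] := @expR_poly_bounded R ('X^2 * ('X - 1) ^+ 2).
have C0 : 0 <= C by apply: le_trans (HC 1 ltr01).
pose V := \int[leb]_(x in B) (1 : R).
exists (m%:R * C * (N%:R * V)) => eps e0.
have oB := @open_unit_ball R N; have mB := @measurable_unit_ball R N.
have t1 := cutoff_test 1 e0; have tX := cutoff_test 'X e0; have tX2 := cutoff_test 'X^2 e0.
have ib := @radial_ibp (m%:R * eps ^+ m) (cutoff eps 1) (cutoff eps 'X^2) t1
  (test_csupp tX2) (test_Ck 0 B tX2).
have i1 : leb.-integrable B (EFin \o (fun x => rhoV N x * dotp x x * cutoff eps 'X^2 x)).
  apply: csupp_integrable_ball; first by apply: csupp_mull; exact: test_csupp.
  apply: Ck_mul => //; last exact: test_Ck.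
  by apply: Ck_mul => //; [exact: Ck_rhoV|exact: Ck_dotp].
have i2 := csupp_integrable_ball (energy_csupp (test_csupp tX)) (energy_Ck (test_Ck 1 B tX)).
have i3 : leb.-integrable B (EFin \o cutoff eps 1).
  by apply: csupp_integrable_ball; [exact: test_csupp|exact: test_Ck].
have i4 : leb.-integrable B (EFin \o (cst 1 : E -> R)).
  by apply: (@integrable_bounded_ball _ 1) => // x _; rewrite /= normr1.
apply: (@le_trans _ _ (eps ^+ m * (m%:R ^+ 2 * C * \int[leb]_(x in B) (rhoV N x * dotp x x * cutoff eps 'X^2 x)))).
  rewrite ler_pM2l ?exprn_gt0// -RintegralZl//.
  apply: le_Rintegral => //; first exact: (integrableZl mB _ i1).
  move=> x Bx; have x0 := (unit_ballP x).1 Bx.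
  have W0 := rhoV_ge0 N Bx.
  have -> : dotp (grad (cutoff eps 'X) x) (grad (cutoff eps 'X) x) =
    (m%:R * eps ^+ m * rhoV N x * cutoff eps ('X^2 * ('X - 1)) x) ^+ 2 * dotp x x.
    rewrite /dotp mulr_sumr; apply: eq_bigr => i _.
    by rewrite !mxE partial_cutoff// derivX; ring.
  rewrite (_ : _ * _ = m%:R ^+ 2 * (rhoV N x * dotp x x) *
    ((eps ^+ m * (rho x * rhoV N x)) ^+ 2 * cutoff eps ('X^2 * ('X - 1)) x ^+ 2)); last by ring.
  rewrite [leRHS](_ : _ = m%:R ^+ 2 * (rhoV N x * dotp x x) * (C * cutoff eps 'X^2 x)); last by ring.
  rewrite ler_wpM2l//; first by rewrite !mulr_ge0 ?sqr_ge0 ?dotp_ge0.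
  rewrite rho_rhoV//.
  have [c0|c0] := eqVneq (cutoff eps ('X^2 * ('X - 1)) x) 0.
    by rewrite c0 expr0n/= mulr0 mulr_ge0// cutoffE// flat_X2_ge0.
  have [_ eW] := cutoff_core e0 c0.
  apply: (@le_trans _ _ (cutoff eps ('X^2 * ('X - 1)) x ^+ 2)).
    have eW0 : 0 <= eps ^+ m * rhoV m x.
      by apply: mulr_ge0; [exact/exprn_ge0/ltW|exact: rhoV_ge0].
    by apply: ler_piMl; [exact: sqr_ge0|rewrite expr_le1].
  rewrite !cutoffE// /flat; case: ifPn => [z0|_]; last by rewrite expr0n/= mulr0.
  have := HC (1 - eps ^+ m * rhoV m x)^-1; rewrite invr_gt0 z0 => /(_ isT).
  move: (_^-1) => y hy; have ey := expR_ge0 (- y).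
  have {}hy : y ^+ 2 * (y - 1) ^+ 2 * expR (- y) <= C.
    apply: le_trans hy; apply: le_trans (ler_norm _).
    by rewrite hornerM hornerXn horner_exp hornerD hornerN hornerX hornerC.
  rewrite hornerM !hornerXn hornerD hornerN hornerX hornerC.
  rewrite [leLHS](_ : _ = y ^+ 2 * (y - 1) ^+ 2 * expR (- y) * (y ^+ 2 * expR (- y))); last by ring.
  by rewrite ler_wpM2r// mulr_ge0// sqr_ge0.
have : m%:R * eps ^+ m * \int[leb]_(x in B) (rhoV N x * dotp x x * cutoff eps 'X^2 x) <= N%:R * V.
  rewrite ib => [|i x Bx]; last by rewrite partial_cutoff// derivC subr0 mulr1.
  rewrite ler_wpM2l//; apply: le_Rintegral => // x Bx.
  by rewrite cutoffE//; exact: flat1_le1.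
move=> h; have := ler_wpM2l (mulr_ge0 (ler0n R m) C0) h; apply: le_trans.
by rewrite le_eqVlt; apply/orP; left; apply/eqP; ring.
Qed.

(** Dominated convergence against the integrable [v ^ 2 * rhoV m]. The remaining factor
    [eps ^ m * phi ^ 2 / rho] tends to [0] at each point, and is bounded because [rho >= eps] on the
    support and [eps ^ m / eps <= 1]. *)
Lemma cutoff_tail (v : E -> R) : (0 < m)%N ->
  leb.-integrable B (EFin \o (fun x => v x ^+ 2 * rhoV m x)) ->
  (fun k => (k.+1%:R^-1) ^+ m * \int[leb]_(x in B)
     (cutoff (k.+1%:R^-1) 'X x ^+ 2 * rhoV N x * v x ^+ 2)) @ \oo --> (0 : R).
Proof.
move=> m0 ia; have oB := @open_unit_ball R N; have mB := @measurable_unit_ball R N.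
have [C C0 HC] := flat_bounded 'X.
have e0 k : 0 < (k.+1%:R^-1 : R) by rewrite invr_gt0.
have e1 k : (k.+1%:R^-1 : R) <= 1 by rewrite invf_le1 ?ler1n.
have HC2 eps x : B x -> cutoff eps 'X x ^+ 2 <= C ^+ 2.
  move=> Bx; rewrite cutoffE// -real_normK ?num_real// lerXn2r ?nnegrE// ?HC//.
  exact: ltW.
pose phi (k : nat) (x : E) : R := (k.+1%:R^-1) ^+ m * (cutoff (k.+1%:R^-1) 'X x ^+ 2 * rhoV 1 x).
have phi0 k x : B x -> 0 <= phi k x.
  move=> Bx; apply: mulr_ge0; first exact/exprn_ge0/ltW.
  by apply: mulr_ge0; [exact: sqr_ge0|exact: rhoV_ge0].
have mphi k : measurable_fun B (phi k).
  apply: (@Ck_measurable _ _ 0); apply: Ck_mul => //; first exact: Ck_cst.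
  by apply: Ck_mul => //; [apply: Ck_exp => //; exact: cutoff_Ck|exact: Ck_rhoV].
have bphi k x : B x -> `|phi k x| <= C ^+ 2.
  move=> Bx; rewrite ger0_norm ?phi0//.
  rewrite /phi; have [->|c0] := eqVneq (cutoff (k.+1%:R^-1) 'X x) 0.
    by rewrite expr0n/= mul0r mulr0 sqr_ge0.
  have [ex _] := cutoff_core (e0 k) c0.
  have h : (k.+1%:R^-1) ^+ m * rhoV 1 x <= 1.
    have W1 := rhoV_le_core 1 (e0 k) ex; rewrite expr1 in W1.
    apply: le_trans (ler_wpM2l _ W1) _; first exact/exprn_ge0/ltW.
    rewrite -(prednK m0) exprSr -mulrA divff ?lt0r_neq0// mulr1.
    by rewrite exprn_ile1// ltW.
  rewrite mulrCA -[leRHS]mulr1; apply: ler_pM => //; first exact: sqr_ge0.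
    by apply: mulr_ge0; [exact/exprn_ge0/ltW|exact: rhoV_ge0].
  exact: HC2.
have cphi : {ae leb, forall x, B x -> v x ^+ 2 * rhoV m x != 0 -> phi ^~ x @ \oo --> (0 : R)}.
  apply: aeW => x Bx _.
  have c1 : (fun k => k.+1%:R^-1 * (C ^+ 2 * rhoV 1 x) : R) @ \oo --> (0 : R).
    rewrite [X in _ --> X](_ : _ = 0 * (C ^+ 2 * rhoV 1 x)); last by rewrite mul0r.
    by apply: cvgMl; exact: cvg_harmonic.
  apply: (squeeze_cvgr _ (cvg_cst 0) c1); apply: nearW => k; rewrite phi0//=.
  apply: ler_pM.
  - exact/exprn_ge0/ltW.
  - by apply: mulr_ge0; [exact: sqr_ge0|exact: rhoV_ge0].
  - by rewrite -[leRHS]expr1; apply: ler_wiXn2l => //; exact: ltW.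
  - by apply: ler_wpM2r; [exact: rhoV_ge0|exact: HC2].
have [_] := cvg_Rintegral_mul (psi := cst 0) mB ia mphi (measurable_cst _) cphi bphi.
rewrite (_ : \int[leb]_(x in B) (v x ^+ 2 * rhoV m x * cst 0 x) = 0); last first.
  by under eq_Rintegral do rewrite /= mulr0; rewrite Rintegral_cst// mul0r.
move=> lim0; rewrite [X in X @ _](_ : _ = fun k =>
    \int[leb]_(x in B) (v x ^+ 2 * rhoV m x * phi k x))//; apply/funext => k.
have sc : csupp (fun x => cutoff (k.+1%:R^-1) 'X x ^+ 2 * rhoV 1 x).
  by apply: csupp_mulr; exact/csupp_sqr/cutoff_csupp.
have cc : Ck 0 B (fun x => cutoff (k.+1%:R^-1) 'X x ^+ 2 * rhoV 1 x).
  by apply: Ck_mul => //; [apply: Ck_exp => //; exact: cutoff_Ck|exact: Ck_rhoV].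
have [D D0 HD] := csupp_bounded sc cc.
have i1 := integrable_mul_bounded ia (Ck_measurable cc) (fun x _ => HD x).
rewrite [LHS](_ : _ = (k.+1%:R^-1) ^+ m * \int[leb]_(x in B)
   (v x ^+ 2 * rhoV m x * (cutoff (k.+1%:R^-1) 'X x ^+ 2 * rhoV 1 x))); last first.
  congr (_ * _); apply: eq_Rintegral => x _.
  by rewrite (_ : rhoV N x = rhoV m x * rhoV 1 x) /rhoV ?expr1 ?exprSr//; ring.
by rewrite -RintegralZl//; apply: eq_Rintegral => x _; rewrite /phi; ring.
Qed.

End radial_cutoff.

(** * Nonexistence *)

Section nonexistence.
Context {R : realType} (m : nat).
Local Notation N := m.+1.
Local Notation E := 'rV[R]_N.
Local Notation leb := (@lebesgue_rV R N).
Local Notation B := (@unit_ball R N).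

Lemma positive_representative (u : E -> R) : measurable_fun B u -> positive_on_ball u ->
  exists v : E -> R, [/\ measurable_fun B v, forall x, 0 < v x &
    {ae leb, forall x, B x -> u x = v x}].
Proof.
move=> mu_ pu; exists (fun x => if 0 < u x then u x else 1); split.
- apply: measurable_fun_if => //; first exact: measurable_unit_ball.
  + exact: measurable_fun_ltr.
  + by apply: measurable_funS mu_ => //; exact: measurable_unit_ball.
- by move=> x; case: ifP.
- by apply: filterS pu => x /[swap] Bx /(_ Bx) ->.
Qed.

Theorem no_positive_solution (lam p theta : R) (u : E -> R) : (0 < m)%N -> theta < 0 ->
  calH1 u -> positive_solution lam p theta u -> False.
Proof.
move=> m0 th0 cu [sol pos]; have mB := @measurable_unit_ball R N.
have iu := calH1_weighted_integrable m0 cu.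
have [G [f [wG tf _ lim]]] := cu.
have [[mu_ Lu] _ _] := wG.
have [v [mv v0 uv]] := positive_representative mu_ pos.
have uv2 : {ae leb, forall x, B x -> u x ^+ 2 * rhoV m x = v x ^+ 2 * rhoV m x}.
  by apply: filterS uv => x Hx Bx; rewrite Hx.
have mv2 : measurable_fun B (fun x => v x ^+ 2 * rhoV m x).
  by apply/measurable_EFinP; exact: measurable_weighted.
have iv := ae_eq_integrable mB mv2 uv2 iu.
have lv : locint (fun x => v x ^+ 2).
  split=> [|K cK KB]; first exact: measurable_funX.
  have mK := compact_measurable_rV cK.
  apply: (ae_eq_integrable mK _ _ ((L2loc_sqr (conj mu_ Lu)).2 K cK KB)).
    by apply: measurable_funS KB _ => //; exact: measurable_funX.
  by apply: filterS uv => x Hx Kx; rewrite Hx//; exact: KB.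
have [K2 HK2] := @cutoff_energy_le R m.
pose c : R := N%:R / (2 * m%:R) * (expR (- 2) ^+ 2 * quarter_mass m).
have c0 : 0 < c.
  by rewrite !mulr_gt0 ?invr_gt0 ?mulr_gt0 ?ltr0n ?quarter_mass_gt0// exprn_gt0 ?expR_gt0.
(* With this [M] the mass term exceeds the energy term by at least [1], more than the [1 / 2]
   allowed below to the [v ^ 2] term. [L] then solves an affine equation with slope [- 2 * theta],
   and [C] is determined before [eps]. *)
pose M : R := `|4 / 3 * K2 + 1| / c.
have M0 : 0 <= M by rewrite divr_ge0// ltW.
pose L : R := (lam - 1 - M) / (2 * theta) - 1.
have ML : lam - 2 * theta * (L + 1) - 1 = M.
  by rewrite /L subrK; field; rewrite lt_eqF.
pose C : R := (- 2 * theta * expR L) ^+ 2 / 4.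
have C0 : 0 <= C by rewrite divr_ge0 ?sqr_ge0.
have tail := cutoff_tail m0 iv.
have [k [k8 Hk]] : exists k : nat, (7 <= k)%N /\
    C * ((k.+1%:R^-1) ^+ m * \int[leb]_(x in B) (cutoff (k.+1%:R^-1) 'X x ^+ 2 * rhoV N x * v x ^+ 2)) <= 2^-1.
  have C1 : 0 < 2^-1 / (C + 1) by rewrite divr_gt0// ltr_wpDl.
  have /cvgr0Pnorm_le/(_ _ C1)[k1 _ Hk1] := tail.
  (* The shift by [7] ensures [eps = 1 / (k + 1) <= 1 / 8], as [cutoff_mass_ge] requires. *)
  exists (k1 + 7)%N; split; first by rewrite leq_addl.
  have := Hk1 _ (leq_addr 7 k1); rewrite /= => h.
  have {}h := le_trans (ler_norm _) h.
  apply: le_trans (ler_wpM2l C0 h) _.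
  rewrite mulrCA ler_piMr// ler_pdivrMr ?ltr_wpDl// mul1r; lra.
set eps : R := k.+1%:R^-1 in Hk.
have e0 : 0 < eps by rewrite invr_gt0.
have e8 : eps <= 8^-1 by rewrite lef_pV2 ?posrE// ler_nat.
have em : 0 < eps ^+ m by rewrite exprn_gt0.
have := supersolution_inequality L th0 wG sol mv uv v0 lv tf lim (cutoff_test m 'X e0).
rewrite ML -/C => /(ler_wpM2l (ltW em)).
have := cutoff_mass_ge m0 e0 e8; have := HK2 eps e0; rewrite -/c.
move: Hk; set A1 := \int[leb]_(x in B) _; set A2 := \int[leb]_(x in B) _; set A3 := \int[leb]_(x in B) _.
rewrite mulrCA [eps ^+ m * (_ + _)]mulrDr [eps ^+ m * (M * _)]mulrCA.
move=> h1 h2 h3; rewrite [eps ^+ m * (4 / 3 * _)]mulrCA => h4.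
have h5 := ler_wpM2l M0 h3.
have h6 : 4 / 3 * K2 + 1 <= M * c by rewrite /M divfK ?ler_norm// lt0r_neq0.
lra.
Qed.

End nonexistence.

Theorem theorem1p3 (R : realType) (N : nat) (lam p theta : R)
  (hNp : ((3 <= N)%N /\ 1 < p <= two_star N - 1) \/ (N = 2%N /\ 1 < p))
  (htheta : theta < 0) :
  (forall u : 'rV[R]_N -> R,
     calH1 u -> positive_solution lam p theta u ->
     exists v : 'rV[R]_N -> R,
       [/\ smooth_on (unit_ball N) v,
           eq_on_ball_ae u v &
           exists R0 C0 : R,
             [/\ 0 < R0, 0 < C0 &
              forall x : 'rV[R]_N, unit_ball N x -> R0 <= hdist0 x ->
                C0 * sinh (hdist0 x / 2) ^- (N.-1) <= v x]])
  /\
  ~ (exists u : 'rV[R]_N -> R, calH1 u /\ positive_solution lam p theta u).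
Proof.
have [m m0 NE] : exists2 m, (0 < m)%N & N = m.+1.
  case: hNp => [[N3 _]|[-> _]]; last by exists 1%N.
  by case: N N3 => [//|[//|k]] _; exists k.+1.
subst N.
split=> [u cu pu|[u [cu pu]]]; last exact: no_positive_solution m0 htheta cu pu.
by have := no_positive_solution m0 htheta cu pu.
Qed.
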